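(* Let $N\ge 3$, $p\ge 1$, $q>0$, $\alpha=N$ and $\beta>0$. There exists $\lambda>0$ such that the inequality $$\Delta^2 u-\lambda\Delta u\ \ge\ (K_{N,\beta}*u^p)\,u^q\quad\text{in }\mathbb{R}^N$$ has a nontrivial non-negative solution if and only if $$p+q>\frac{N}{N-2}.$$
   Context: $K_{N,\beta}(x)=|x|^{-N}\log^{\beta}(1+|x|)$ for $x\in\mathbb{R}^N\setminus\{0\}$, where $\log^\beta(s)=(\log s)^\beta$, and $(K_{N,\beta}*u^p)(x)=\int_{\mathbb{R}^N}K_{N,\beta}(x-y)\,u(y)^p\,dy$. A non-negative solution of the inequality is a function $u\in C^4(\mathbb{R}^N)$ such that $u(x)\ge 0$ and $(K_{N,\beta}*u^p)(x)<\infty$ for all $x\in\mathbb{R}^N$, and the inequality holds pointwise in $\mathbb{R}^N$. Nontrivial means $u\not\equiv 0$. *)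

(* Defs.v *)
From HB Require Import structures.
From mathcomp Require Import all_boot all_order all_algebra.
From mathcomp Require Import all_classical all_reals all_analysis.

Set Implicit Arguments.
Unset Strict Implicit.
Unset Printing Implicit Defensive.

Import Order.TTheory GRing.Theory Num.Theory.
Import numFieldNormedType.Exports.

Local Open Scope classical_set_scope.
Local Open Scope ring_scope.

Section sigma_finite_measure_of.
Context {d} {T : measurableType d} {R : realType}.
Variables (mu : {measure set T -> \bar R}) (sfmu : sigma_finite setT mu).

Definition with_sigma_finite (_ : sigma_finite setT mu) : set T -> \bar R := mu.
Local Notation nu := with_sigma_finite.
HB.instance Definition _ := Measure.on (nu sfmu).
HB.instance Definition _ := Measure_isSigmaFinite.Build _ _ _ (nu sfmu) sfmu.

Lemma sigma_finite_measure_of :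
  exists m : {sigma_finite_measure set T -> \bar R}, mu = m :> (set T -> \bar R).
Proof. by exists (nu sfmu). Qed.

End sigma_finite_measure_of.

(* Lebesgue measure on R^n, on the Borel sigma-algebra (the product
   sigma-algebra that the library puts on [n.-tuple]).  The one-point space
   R^0 has mass 1, and R^(n+1) is identified with R * R^n. *)
Section lebesgue_measure_tuple.
Context {R : realType}.
Local Notation rT := (measurableTypeR R).

Definition tuple_of_pair n (z : rT * n.-tuple rT) : n.+1.-tuple rT :=
  [the n.+1.-tuple rT of z.1 :: z.2].

Fixpoint lebesgue_measure_tuple n : set (n.-tuple rT) -> \bar R :=
  if n is m.+1 return set (n.-tuple rT) -> \bar R
  then pushforward (lebesgue_measure \x @lebesgue_measure_tuple m)%E
         (@tuple_of_pair m)
  else dirac [tuple].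

Lemma measurable_tuple_of_pair n : measurable_fun setT (@tuple_of_pair n).
Proof. by apply: measurable_cons. Qed.

Lemma measurable_pair_of_tuple n : measurable_fun setT
  (fun t : n.+1.-tuple rT => (thead t, [tuple of behead t])).
Proof.
by apply/measurable_fun_pair; [exact: measurable_tnth|exact: measurable_behead].
Qed.

Lemma tuple_of_pairK n :
  cancel (fun t : n.+1.-tuple rT => (thead t, [tuple of behead t]))
         (@tuple_of_pair n).
Proof. by move=> t; rewrite [RHS]tuple_eta; apply/val_inj. Qed.

Lemma pair_of_tupleK n :
  cancel (@tuple_of_pair n) (fun t => (thead t, [tuple of behead t])).
Proof.
by move=> [a t]; rewrite /tuple_of_pair /= theadE; congr pair; apply/val_inj.
Qed.

Lemma lebesgue_measure_tuple_ex n :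
  exists mu : {sigma_finite_measure set (n.-tuple rT) -> \bar R},
    @lebesgue_measure_tuple n = mu.
Proof.
elim: n => [|n [mu muE]].
  pose P : {measure set (0.-tuple rT) -> \bar R} := \d_([tuple] : 0.-tuple rT).
  have sf : sigma_finite setT P.
    exists (fun=> setT); first by rewrite bigcup_const//; exists 0%N.
    by move=> k; split => //; rewrite /P /= diracT ltry.
  exact: (sigma_finite_measure_of sf).
rewrite /= muE.
pose P : {measure set _ -> \bar R} :=
  measure_function_pushforward__canonical__measure_function_Measure
    (lebesgue_measure \x mu)%E (@measurable_tuple_of_pair n).
have sf : sigma_finite setT P.
  have /sigma_finiteP[F [TF ndF Foo]] := sigma_finiteT (@lebesgue_measure R).
  have /sigma_finiteP[G [TG ndG Goo]] := sigma_finiteT mu.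
  pose g (t : n.+1.-tuple rT) := (thead t, [tuple of behead t]).
  exists (fun k => g @^-1` (F k `*` G k)).
    rewrite predeqE => t; split => // _.
    have [i _ Fi] : (\bigcup_i F i) (thead t) by rewrite -TF.
    have [j _ Gj] : (\bigcup_i G i) [tuple of behead t] by rewrite -TG.
    exists (maxn i j) => //; split => /=.
    - by move: (thead t) Fi; exact/subsetPset/ndF/leq_maxl.
    - by move: [tuple of behead t] Gj; exact/subsetPset/ndG/leq_maxr.
  move=> k; have [mFk Fkoo] := Foo k; have [mGk Gkoo] := Goo k; split.
    rewrite -[X in measurable X]setTI.
    by apply: measurable_pair_of_tuple => //; exact: measurableX.
  rewrite /= /pushforward -comp_preimage (_ : g \o _ = id).
    by rewrite preimage_id product_measure1E// lte_mul_pinfty// ge0_fin_numE.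
  by apply/funext => z; exact: pair_of_tupleK.
exact: (sigma_finite_measure_of sf).
Qed.

Let leb0 n : @lebesgue_measure_tuple n set0 = 0%E.
Proof. by have [mu ->] := lebesgue_measure_tuple_ex n; rewrite measure0. Qed.

Let leb_ge0 n A : (0 <= @lebesgue_measure_tuple n A)%E.
Proof. by have [mu ->] := lebesgue_measure_tuple_ex n. Qed.

Let leb_sigma_additive n : semi_sigma_additive (@lebesgue_measure_tuple n).
Proof.
have [mu ->] := lebesgue_measure_tuple_ex n.
exact: measure_semi_sigma_additive.
Qed.

HB.instance Definition _ n := isMeasure.Build _ _ _ (@lebesgue_measure_tuple n)
  (@leb0 n) (@leb_ge0 n) (@leb_sigma_additive n).

Let leb_sigma_finite n : sigma_finite setT (@lebesgue_measure_tuple n).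
Proof.
by have [mu ->] := lebesgue_measure_tuple_ex n; exact: sigma_finiteT.
Qed.

HB.instance Definition _ n := Measure_isSigmaFinite.Build _ _ _
  (@lebesgue_measure_tuple n) (@leb_sigma_finite n).

Lemma lebesgue_measure_tuple_box n (A : 'I_n -> set rT) :
  (forall i, measurable (A i)) ->
  lebesgue_measure_tuple [set t | forall i, A i (tnth t i)] =
  (\prod_(i < n) lebesgue_measure (A i))%E.
Proof.
elim: n A => [|n IH] A mA.
  rewrite big_ord0 /= diracE mem_set//.
  by move=> -[].
rewrite big_ord_recl -IH//= /pushforward.
rewrite -product_measure1E//; last first.
  rewrite (_ : [set t | _] = \bigcap_(i in [set: 'I_n])
      ((fun t => tnth t i) @^-1` A (lift ord0 i))).
    apply: fin_bigcap_measurable => // i _.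
    by rewrite -[X in measurable X]setTI; exact: measurable_tnth.
  by apply/seteqP; split => [t h i _|t h i]; exact: h.
congr (product_measure1 _ _ _); apply/seteqP; split => -[a t] /=.
  move=> h; split; first exact: (h ord0).
  by move=> i; have := h (lift ord0 i); rewrite tnthS.
move=> [Aa At] i; have [j ->|->] := unliftP ord0 i.
- by rewrite tnthS; exact: At.
- by [].
Qed.

End lebesgue_measure_tuple.
Arguments lebesgue_measure_tuple {R} n.

Section differential_operators.
Context {R : realType} {n : nat}.
Implicit Types u : 'rV[R]_n -> R.

Definition partial (i : 'I_n) u : 'rV[R]_n -> R :=
  fun x => 'D_(delta_mx 0 i) u x.

Fixpoint class_C (k : nat) u : Prop :=
  if k is m.+1 then
    continuous u /\
    (forall i, (forall x, derivable u x (delta_mx 0 i)) /\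
               class_C m (partial i u))
  else continuous u.

Definition laplacian u : 'rV[R]_n -> R :=
  fun x => \sum_(i < n) partial i (partial i u) x.

Definition bilaplacian u : 'rV[R]_n -> R := laplacian (laplacian u).

End differential_operators.

Section convolution_inequality.
Context {R : realType} {n : nat}.
Implicit Types (u : 'rV[R]_n -> R) (x : 'rV[R]_n).

(* The norm that the library puts on row vectors is the sup norm. *)
Definition enorm x : R := Num.sqrt (\sum_(i < n) x 0 i ^+ 2).

(* The value at the origin, where the kernel is not defined, is a junk one; it
   does not affect the convolution, since points are negligible for n > 0. *)
Definition log_kernel (alpha beta : R) x : R :=
  enorm x `^ (- alpha) * ln (1 + enorm x) `^ beta.

Definition row_of_tuple (t : n.-tuple (measurableTypeR R)) : 'rV[R]_n :=
  \row_i tnth t i.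

(* Extended-real valued: it is applied to non-negative K and f, whose
   convolution may be infinite. *)
Definition convolution (K f : 'rV[R]_n -> R) x : \bar R :=
  (\int[lebesgue_measure_tuple n]_t
     (K (x - row_of_tuple t) * f (row_of_tuple t))%:E)%E.

Definition nonneg_solution (lambda alpha beta p q : R) u : Prop :=
  let conv := convolution (log_kernel alpha beta) (fun y => u y `^ p) in
  [/\ class_C 4 u,
      forall x, 0 <= u x,
      forall x, (conv x < +oo)%E &
      forall x, (conv x * (u x `^ q)%:E <=
                 (bilaplacian u x - lambda * laplacian u x)%:E)%E].

End convolution_inequality.

(* Main.v *)
(* Put v := lambda u - Delta u, so that the inequality reads
   - Delta v >= (K * u^p) u^q, with a non-negative right-hand side.

   Nonexistence.  Finiteness of K * u^p bounds the integral of u over a ball of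
   radius r by C r^N, which is incompatible with a negative value of the
   superharmonic function v; hence v >= 0.  If u z > 0, let M be the infimum of
   v over the ball of radius r/2 about z.  Comparison with |x|^(2-N) gives
   M >= c r^(2-N) and v >= c M on the ball of radius 4r, so u >= c M on the
   ball of radius 2r, by comparison for - Delta + lambda.  There the
   convolution is at least c M^p ln(1 + r/2)^beta, and comparing v with a
   paraboloid yields M >= c M^(p+q) r^2 ln(1 + r/2)^beta.  When
   p + q <= N/(N-2), the lower bound on M makes M^(p+q-1) r^2 bounded below,
   and the logarithm gives a contradiction as r grows.

   Existence.  Take u := eps (1 + |x|^2)^(-s) with 2s = N - 2 - d, d small.
   Since d > 0, - Delta u is at least a multiple of (1 + |x|^2)^(-s-1), which
   also dominates the bilaplacian; so a large lambda makes the
   left-hand side at least eps (1 + |x|^2)^(-s-1).  As ln(1 + r) <= C r^(d/beta),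
   the kernel is at most a Riesz kernel C |x|^(d-N), and the convolution is at
   most C eps^p (1 + |x|^2)^(d - min(2sp, N)/2).  The condition on p + q makes
   the right-hand side at most C eps^(p+q) (1 + |x|^2)^(-s-1), and
   p + q > 1 lets eps absorb C. *)
Require Import Defs.
From HB Require Import structures.
From mathcomp Require Import all_boot all_order all_algebra.
From mathcomp Require Import all_classical all_reals all_analysis.
From mathcomp Require Import measurable_realfun ring lra.

Set Implicit Arguments.
Unset Strict Implicit.
Unset Printing Implicit Defensive.

Import Order.TTheory GRing.Theory Num.Theory.
Import numFieldNormedType.Exports.

Local Open Scope classical_set_scope.
Local Open Scope ring_scope.

(** * Differential calculus on row vectors *)

(** The threshold is read off an exponent: M >= c r^(2-N) gives M^(p+q-1) r^2 >= c'
    r^(2-(N-2)(p+q-1)), and this power of r is nonnegative exactly when p + q <= N/(N-2). At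
    equality only the logarithm, unbounded since beta > 0, decides; hence every other constant has
    to be fixed before r.

    Means over balls are replaced by integrals against (T - |x-z|^2)_+^k: d/dT and the Laplacian
    both lower k, so Green's identity, free of boundary terms, becomes a differential inequality in
    T. All later comparisons use one minimum principle on the whole space, with barriers that are
    polynomials or powers of 1 + c |x-z|^2, hence smooth at the centre.

    For existence, d has two roles: it is the coefficient of (1 + |x|^2)^(-s-1) in - Delta u up to a
    factor 2s, which would vanish at the decay |x|^(2-N), and it pays for the logarithm. *)

Section partial_derivatives.
Context {R : realType} {n : nat}.
Implicit Types (u v w : 'rV[R]_n -> R) (x z : 'rV[R]_n).

(** Partial derivatives become one-variable derivatives along a line, so that the chain rule on the
    real line applies to them. *)
Lemma is_derive_lineP u x (v : 'rV[R]_n) d :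
  is_derive x v u d <-> is_derive (0 : R) 1 (fun h => u (h *: v + x)) d.
Proof.
have E : (fun h : R => h^-1 *: ((u \o shift x) (h *: v) - u x)) =
    (fun h : R => h^-1 *:
      (((fun h => u (h *: v + x)) \o shift 0) (h *: 1) - u (0 *: v + x))).
  by apply/funext => h /=; rewrite addr0 scale0r add0r [_%:A]mulr1.
split=> -[dv <-]; split; rewrite /derivable /derive ?E //.
- by move: dv; rewrite /derivable E.
Qed.

Lemma partialE i u x d : is_derive x (delta_mx 0 i) u d -> partial i u x = d.
Proof. by move=> ?; rewrite /partial derive_val. Qed.

Lemma class_C_continuous k u : class_C k u -> continuous u.
Proof. by case: k => //= k []. Qed.

Lemma class_C_is_derive k u i x : class_C k.+1 u ->
  is_derive x (delta_mx 0 i) u (partial i u x).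
Proof. by move=> [_ /(_ i)[+ _]] => /(_ x) /derivableP. Qed.

Lemma class_C_partial k u i : class_C k.+1 u -> class_C k (partial i u).
Proof. by move=> [_ /(_ i)[]]. Qed.

Lemma class_CW k u : class_C k.+1 u -> class_C k u.
Proof.
elim: k u => [|k IH] u; first by case.
move=> [cu Cu]; split => // i; have [du Ciu] := Cu i; split => //.
exact: IH.
Qed.

Lemma class_C_intro k u (du : 'I_n -> 'rV[R]_n -> R) : continuous u ->
  (forall i x, is_derive x (delta_mx 0 i) u (du i x)) ->
  (forall i, class_C k (du i)) -> class_C k.+1 u.
Proof.
move=> cu dU Cdu; split => // i.
have E : partial i u = du i by apply/funext => x; exact: partialE.
by split; [move=> x; have := dU i x; case|rewrite E].
Qed.

Lemma class_C_cst k (c : R) : class_C k (fun _ : 'rV[R]_n => c).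
Proof.
elim: k c => [|k IH] c; first exact: cst_continuous.
apply: (@class_C_intro k _ (fun _ _ => 0)) => //; first exact: cst_continuous.
Qed.

Lemma class_CD k u v : class_C k u -> class_C k v ->
  class_C k (fun x => u x + v x).
Proof.
elim: k u v => [|k IH] u v Cu Cv.
  have cu := class_C_continuous Cu; have cv := class_C_continuous Cv.
  by move=> x; exact: (cvgD (cu x) (cv x)).
apply: (@class_C_intro k _ (fun i x => partial i u x + partial i v x)).
- move=> x.
  exact: (cvgD (class_C_continuous Cu (x := x)) (class_C_continuous Cv (x := x))).
- move=> i x.
  exact: (is_deriveD (class_C_is_derive i x Cu) (class_C_is_derive i x Cv)).
- by move=> i; apply: IH; exact: class_C_partial.
Qed.

Lemma class_CM k u v : class_C k u -> class_C k v ->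
  class_C k (fun x => u x * v x).
Proof.
elim: k u v => [|k IH] u v Cu Cv.
  have cu := class_C_continuous Cu; have cv := class_C_continuous Cv.
  by move=> x; exact: (cvgM (cu x) (cv x)).
apply: (@class_C_intro k _ (fun i x => u x * partial i v x + v x * partial i u x)).
- move=> x.
  exact: (cvgM (class_C_continuous Cu (x := x)) (class_C_continuous Cv (x := x))).
- move=> i x.
  exact: (is_deriveM (class_C_is_derive i x Cu) (class_C_is_derive i x Cv)).
- by move=> i; apply: class_CD; apply: IH;
    do ?[exact: class_C_partial | exact: class_CW].
Qed.

Lemma class_C_sum k m (F : 'I_m -> 'rV[R]_n -> R) :
  (forall i, class_C k (F i)) -> class_C k (fun x => \sum_(i < m) F i x).
Proof.
move=> CF; rewrite (_ : (fun _ => _) = (\sum_(i < m) F i)); last first.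
  by apply/funext => x; rewrite fct_sumE.
elim/big_ind : _ => //; first exact: class_C_cst.
by move=> u v; exact: class_CD.
Qed.

Lemma is_derive_coord (i j : 'I_n) x :
  is_derive x (delta_mx 0 i) (fun y : 'rV[R]_n => y 0 j) ((i == j)%:R : R).
Proof.
apply/is_derive_lineP.
rewrite (_ : (fun _ => _) =
    (fun h : R => (i == j)%:R *: h) \+ cst (x 0 j)); last first.
  by apply/funext => h /=; rewrite !mxE /= eq_sym mulrC.
apply: is_derive_eq; by rewrite addr0 [_%:A]mulr1.
Qed.

Lemma continuous_coord (j : 'I_n) : continuous (fun y : 'rV[R]_n => y 0 j).
Proof. by move=> x; exact: coord_continuous. Qed.

Lemma class_C_coord k (j : 'I_n) : class_C k (fun y : 'rV[R]_n => y 0 j).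
Proof.
case: k => [|k]; first exact: continuous_coord.
apply: (@class_C_intro k _ (fun i _ => (i == j)%:R)).
- exact: continuous_coord.
- move=> i x; exact: is_derive_coord.
- move=> i; exact: class_C_cst.
Qed.

Lemma class_C_laplacian k u : class_C k.+2 u -> class_C k (laplacian u).
Proof.
by move=> Cu; apply: class_C_sum => i; do 2 apply: class_C_partial.
Qed.

Lemma laplacianD u v x : class_C 2 u -> class_C 2 v ->
  laplacian (fun x => u x + v x) x = laplacian u x + laplacian v x.
Proof.
move=> Cu Cv; rewrite /laplacian -big_split /=; apply: eq_bigr => i _.
have -> : partial i (fun x => u x + v x) =
    fun x => partial i u x + partial i v x.
  apply/funext => y; apply: partialE; apply: is_deriveD;
  [exact: class_C_is_derive Cu|exact: class_C_is_derive Cv].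
apply: partialE; apply: is_deriveD.
- exact: (class_C_is_derive _ _ (class_C_partial i Cu)).
- exact: (class_C_is_derive _ _ (class_C_partial i Cv)).
Qed.

Lemma laplacianZ c u x : class_C 2 u ->
  laplacian (fun x => c * u x) x = c * laplacian u x.
Proof.
move=> Cu; rewrite /laplacian mulr_sumr; apply: eq_bigr => i _.
have -> : partial i (fun x => c * u x) = fun x => c * partial i u x.
  by apply/funext => y; apply: partialE; apply: is_deriveZ;
    exact: class_C_is_derive Cu.
apply: partialE; apply: is_deriveZ.
exact: (class_C_is_derive _ _ (class_C_partial i Cu)).
Qed.

(** The squared Euclidean distance is a polynomial, so radial functions written through it lose no
    regularity at the centre. The ambient norm, a sup norm, serves for topology and for cubes. *)
Definition sqdist z x : R := \sum_(i < n) (x 0 i - z 0 i) ^+ 2.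

Lemma sqdist_ge0 z x : 0 <= sqdist z x.
Proof. by apply: sumr_ge0 => i _; exact: sqr_ge0. Qed.

Lemma sqdistC z x : sqdist z x = sqdist x z.
Proof. by apply: eq_bigr => i _; rewrite -sqrrN opprB. Qed.

Lemma sqdist_refl z : sqdist z z = 0.
Proof. by apply: big1 => i _; rewrite subrr expr0n. Qed.

Lemma enorm_sqr x y : enorm (x - y) ^+ 2 = sqdist y x.
Proof.
rewrite /enorm sqr_sqrtr; last by apply: sumr_ge0 => i _; exact: sqr_ge0.
by apply: eq_bigr => i _; rewrite !mxE.
Qed.

Lemma enorm_ge0 x : 0 <= enorm x. Proof. exact: sqrtr_ge0. Qed.

Lemma sqdist_mid x y z : sqdist z y <= 2 * sqdist z x + 2 * sqdist x y.
Proof.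
rewrite !mulr_sumr -big_split /=; apply: ler_sum => i _.
have := sqr_ge0 ((x 0 i - z 0 i) - (y 0 i - x 0 i)); lra.
Qed.

Lemma coord_le_norm x i : `|x 0 i| <= `|x|.
Proof.
rewrite [leRHS]mx_normrE.
exact: (le_bigmax _ (fun ij : 'I_1 * 'I_n => `|x ij.1 ij.2|) (0, i)).
Qed.

Lemma norm_leP x (r : R) : 0 <= r ->
  reflect (forall i, `|x 0 i| <= r) (`|x| <= r).
Proof.
move=> r0; apply: (iffP idP) => [xr i|xr].
  exact: le_trans (coord_le_norm x i) xr.
rewrite [leLHS]mx_normrE; apply/bigmax_leP; split => // -[i j] _ /=.
by rewrite ord1.
Qed.

Lemma norm_sqr_le_sqdist x z : `|x - z| ^+ 2 <= sqdist z x.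
Proof.
rewrite -[leRHS]sqr_sqrtr ?sqdist_ge0// ler_sqr ?nnegrE ?sqrtr_ge0//.
apply/norm_leP; first exact: sqrtr_ge0.
move=> i; rewrite -sqrtr_sqr ler_wsqrtr// !mxE /sqdist (bigD1 i)//=.
by rewrite lerDl; apply: sumr_ge0 => j _; exact: sqr_ge0.
Qed.

Lemma sqdist_le_norm x z : sqdist z x <= n%:R * `|x - z| ^+ 2.
Proof.
rewrite -[n in n%:R]card_ord -sumr_const mulr_suml; apply: ler_sum => i _.
rewrite mul1r -real_normK ?num_real// ler_sqr ?nnegrE//.
by have := coord_le_norm (x - z) i; rewrite !mxE.
Qed.

Lemma continuous_sqdist z : continuous (sqdist z).
Proof.
apply: (@class_C_continuous 0); apply: class_C_sum => i.
by apply: (@class_CM 0); apply: class_CD;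
  do ?[exact: class_C_coord | exact: class_C_cst].
Qed.

Lemma sqdist_line z x i (h : R) :
  sqdist z (h *: delta_mx 0 i + x) =
  sqdist z x + 2 * (x 0 i - z 0 i) * h + h ^+ 2.
Proof.
rewrite /sqdist (bigD1 i)//= [in RHS](bigD1 i)//= !mxE !eqxx /= mulr1.
rewrite (eq_bigr (fun j => (x 0 j - z 0 j) ^+ 2)); last first.
  by move=> j ji; rewrite !mxE (negbTE ji) andbF mulr0 add0r.
ring.
Qed.

Lemma is_derive_radial z x i (G : R -> R) g : is_derive (sqdist z x) 1 G g ->
  is_derive x (delta_mx 0 i) (fun y => G (sqdist z y))
    (g * (2 * (x 0 i - z 0 i))).
Proof.
move=> dG; apply/is_derive_lineP.
rewrite (_ : (fun _ => _) = G \o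
   (fun h : R => sqdist z x + 2 * (x 0 i - z 0 i) * h + h ^+ 2)); last first.
  by apply/funext => h /=; rewrite sqdist_line.
apply: is_derive1_comp; first by rewrite mulr0 addr0 expr0n addr0.
apply: is_derive_eq; rewrite /GRing.scale /=; ring.
Qed.

(** The second derivative in direction [i] is 4 (x_i - z_i)^2 k + 2 g; summing over [i] gives the
    formula. Differentiability is asked only at values of [sqdist], which admits powers with a
    nonsmooth point at negative arguments. *)
Lemma laplacian_radial z (G g k : R -> R) :
  (forall x, is_derive (sqdist z x) 1 G (g (sqdist z x))) ->
  (forall x, is_derive (sqdist z x) 1 g (k (sqdist z x))) ->
  forall x, laplacian (fun y => G (sqdist z y)) x =
    4 * sqdist z x * k (sqdist z x) + 2 * n%:R * g (sqdist z x).
Proof.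
move=> dG dg x; rewrite /laplacian.
rewrite (eq_bigr (fun i => 4 * k (sqdist z x) * (x 0 i - z 0 i) ^+ 2 +
   2 * g (sqdist z x))).
  rewrite big_split /= -mulr_sumr sumr_const card_ord -mulr_natl.
  rewrite -/(sqdist z x); ring.
move=> i _.
have -> : partial i (fun y => G (sqdist z y)) =
    fun y => g (sqdist z y) * (2 * (y 0 i - z 0 i)).
  by apply/funext => y; apply: partialE; exact: is_derive_radial.
apply: partialE.
have := is_derive_radial i (dg x); have := is_derive_coord i i x.
move=> d1 d2.
rewrite (_ : (fun y => _) = (fun y => g (sqdist z y)) \*
   (fun y => 2 *: ((fun y : 'rV[R]_n => y 0 i) \- cst (z 0 i)) y)) //.
apply: is_derive_eq; rewrite eqxx /GRing.scale /=; ring.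
Qed.

End partial_derivatives.

Lemma is_derive_line {R : realType} {n : nat} (u : 'rV[R]_n -> R) x
    (v : 'rV[R]_n) (h : R) d :
  is_derive (h *: v + x) v u d -> is_derive h 1 (fun h => u (h *: v + x)) d.
Proof.
move=> /is_derive_lineP du.
rewrite (_ : (fun _ => _) =
    (fun k => u (k *: v + (h *: v + x))) \o (fun s => s + (- h))); last first.
  by apply/funext => s /=; rewrite addrA -scalerDl subrK.
rewrite -[d]mulr1; apply: is_derive1_comp; first by rewrite subrr.
exact: is_derive_shift.
Qed.

(** If [d < 0] then [df] is negative just to the right of 0, and the mean value theorem gives a
    value of [f] below [f 0]. *)
Lemma second_derivative_at_min {R : realType} (f df : R -> R) (r d : R) :
  0 < r -> (forall h : R, is_derive h 1 f (df h)) -> is_derive (0 : R) 1 df d ->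
  (forall h : R, `|h| < r -> f 0 <= f h) -> 0 <= d.
Proof.
move=> r0 fdf dfd fmin.
have df0 : df 0 = 0.
  have [_ <-] := fdf 0.
  have [] := @derive1_at_min _ f (- r) r 0; first by lra.
  - by move=> t _; case: (fdf t).
  - by rewrite in_itv /=; lra.
  - move=> t; rewrite in_itv /= => tr; apply: fmin; rewrite ltr_norml; lra.
  - by [].
rewrite leNgt; apply/negP => d0.
have [cdf dE] := dfd.
have : h^-1 *: (df (h + 0) - df 0) @[h --> 0^'] --> d.
  move: cdf; rewrite /derivable /=.
  under eq_fun do rewrite /= [_%:A]mulr1.
  move/cvg_ex => [l cl]; rewrite (_ : d = l)//.
  rewrite -dE /derive; apply: cvg_lim => //.
  by under eq_fun do rewrite /= [_%:A]mulr1.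
move/cvgrPdist_lt => /(_ (- d)); rewrite oppr_gt0 => /(_ d0).
move=> [e /= e0 He].
pose b := Num.min e r / 2.
have b0 : 0 < b by rewrite divr_gt0// lt_min e0.
have [be br] : b < e /\ b < r.
  have : Num.min e r <= e by rewrite ge_min lexx.
  have : Num.min e r <= r by rewrite ge_min lexx orbT.
  by rewrite /b; move: b0; rewrite /b; split; lra.
have [|c] := @MVT _ f df 0 b b0 (fun t _ => fdf t).
  apply: derivable_within_continuous => t _; by case: (fdf t).
rewrite in_itv /= => /andP[c0 cb]; rewrite subr0 => fE.
have : f 0 <= f b by apply: fmin; rewrite gtr0_norm.
rewrite -subr_ge0 fE pmulr_lge0// leNgt => /negP; apply.
have := He c; rewrite /ball_ /= sub0r normrN gtr0_norm// => /(_ (lt_trans cb be)).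
rewrite gt_eqF// => /(_ isT); rewrite df0 subr0 addr0 ltr_norml => /andP[+ _].
rewrite ltrBDr => dd.
have : c^-1 *: df c < 0 by move: dd; lra.
by rewrite pmulr_rlt0 ?invr_gt0.
Qed.

(** * The minimum principle on the whole space *)

Section min_principle.
Context {R : realType} {n : nat}.
Implicit Types (w : 'rV[R]_n -> R) (x z : 'rV[R]_n).

Lemma class_C_sqdist k z : class_C k (sqdist z).
Proof.
apply: class_C_sum => i.
by apply: class_CM; apply: class_CD;
  do ?[exact: class_C_coord | exact: class_C_cst].
Qed.

Lemma laplacian_sqdist z x : laplacian (sqdist z) x = 2 * n%:R.
Proof.
rewrite (@laplacian_radial _ _ z id (fun=> 1) (fun=> 0)).
by rewrite mulr0 add0r mulr1.
Qed.

Lemma laplacian_ge0_at_min w z (r : R) : class_C 2 w -> 0 < r ->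
  (forall x, `|x - z| < r -> w z <= w x) -> 0 <= laplacian w z.
Proof.
move=> Cw r0 wmin; apply: sumr_ge0 => i _.
refine (@second_derivative_at_min _ (fun h => w (h *: delta_mx 0 i + z))
  (fun h => partial i w (h *: delta_mx 0 i + z)) r _ r0 _ _ _).
- by move=> h; apply: is_derive_line; exact: class_C_is_derive Cw.
- apply/is_derive_lineP; exact: (class_C_is_derive _ _ (class_C_partial i Cw)).
- move=> h hr; rewrite scale0r add0r; apply: wmin; rewrite addrK.
  rewrite normrZ (le_lt_trans _ hr)// ler_piMr//.
  apply/norm_leP => // j; rewrite !mxE eqxx /=.
  by case: (j == i); rewrite ?normr1 ?normr0.
Qed.

Lemma compact_cube z (r : R) : compact [set x : 'rV[R]_n | `|x - z| <= r].
Proof.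
have [r0|r0] := ltP r 0.
  rewrite (_ : [set _ | _] = set0); first exact: compact0.
  apply/seteqP; split => // x /= xr.
  by have := normr_ge0 (x - z); rewrite leNgt (le_lt_trans xr r0).
rewrite (_ : [set _ | _] =
    [set v : 'rV[R]_n | forall i, `[z 0 i - r, z 0 i + r]%classic (v ord0 i)]).
  apply: (@rV_compact R n (fun i => `[z 0 i - r, z 0 i + r]%classic)) => i.
  exact: segment_compact.
apply/seteqP; split => y /=.
  move/(norm_leP _ r0) => H i; rewrite in_itv /=.
  by have := H i; rewrite !mxE ler_distl.
move=> H; apply/norm_leP => // i.
by rewrite !mxE ler_distl; have := H i; rewrite in_itv.
Qed.

(* A small multiple of |x|^2 is subtracted to make the Laplacian negative at a
   negative interior minimum. *)
Lemma min_principle w : (0 < n)%N -> class_C 2 w ->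
  (forall x, w x < 0 -> laplacian w x <= 0) ->
  (forall e, 0 < e -> exists rho : R, forall x, rho <= `|x| -> - e <= w x) ->
  forall x, 0 <= w x.
Proof.
move=> n0 Cw Lw winf x1; rewrite leNgt; apply/negP => wx1.
have [rho0 Hrho0] : exists rho : R, forall x, rho <= `|x| -> w x1 / 2 <= w x.
  have [|rho H] := winf (- (w x1 / 2)); first by lra.
  by exists rho => x /H; rewrite opprK.
pose rho := Num.max (Num.max rho0 (`|x1|)) 1.
have Hrho x : rho <= `|x| -> w x1 / 2 <= w x.
  by rewrite ge_max ge_max => /andP[/andP[+ _] _]; exact: Hrho0.
have x1rho : `|x1| <= rho by rewrite !le_max lexx orbT.
have rho1 : 1 <= rho by rewrite le_max lexx orbT.
pose nr : R := n%:R.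
have nr0 : 0 < nr by rewrite ltr0n.
(* On the cube of radius [rho], [sqdist 0] is at most n rho^2, so the correction is at most - w x1 /
   4. A minimizer of [W] then has w z <= 3/4 w x1, below the bound w x1 / 2 valid on the boundary,
   and is therefore an interior point where [w] is negative. *)
pose eta := - w x1 / (4 * nr * rho ^+ 2).
have rho_gt0 : 0 < rho by lra.
have D0 : 0 < 4 * nr * rho ^+ 2 by rewrite !mulr_gt0// exprn_gt0.
have eta0 : 0 < eta by rewrite divr_gt0// oppr_gt0.
have etaE : eta * (nr * rho ^+ 2) = - w x1 / 4.
  rewrite /eta; field; rewrite gt_eqF//=; lra.
pose W := fun x => w x + (- eta) * sqdist 0 x.
have Cq : class_C 2 (fun x => (- eta) * sqdist 0 x).
  by apply: class_CM; [exact: class_C_cst|exact: class_C_sqdist].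
have CW : class_C 2 W by exact: class_CD.
have qrho x : `|x| <= rho -> eta * sqdist 0 x <= - w x1 / 4.
  move=> xr; rewrite -etaE ler_pM2l//.
  apply: le_trans (sqdist_le_norm x 0) _.
  by rewrite subr0 ler_pM2l// ler_sqr ?nnegrE//; lra.
have [|||z zrho zmin] := @EVT_min_rV R n W [set x | `|x| <= rho].
- by exists x1.
- have := @compact_cube 0 rho.
  by rewrite (_ : [set _ | _] = [set x | `|x| <= rho])//; apply/funext => y; rewrite /= subr0.
- by apply: continuous_subspaceT; exact: (class_C_continuous CW).
rewrite inE /= in zrho.
have Wz : W z <= w x1.
  apply: le_trans (zmin x1 _) _; first by rewrite inE.
  by rewrite gerDl mulNr oppr_le0 mulr_ge0 ?sqdist_ge0// ltW.
have zlt : `|z| < rho.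
  rewrite lt_neqAle zrho andbT; apply/negP => /eqP zE.
  have := Hrho z; rewrite zE lexx => /(_ isT).
  have := qrho z zrho; move: Wz; rewrite /W; lra.
have wz : w z < 0.
  have := qrho z zrho; move: Wz; rewrite /W; lra.
have : 0 <= laplacian W z.
  apply: (@laplacian_ge0_at_min _ _ (rho - `|z|)) => //; first by lra.
  move=> x xz; apply: zmin; rewrite inE /=.
  have := ler_normD (x - z) z; rewrite subrK; lra.
rewrite laplacianD// laplacianZ ?laplacian_sqdist; last exact: class_C_sqdist.
have := Lw z wz; rewrite -/nr.
have : 0 < eta * (2 * nr) by rewrite mulr_gt0// mulr_gt0.
lra.
Qed.

End min_principle.

(** * Integration over the Lebesgue measure on tuples *)

Section translation.
Context {R : realType}.
Local Notation rT := (measurableTypeR R).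
Local Notation leb n := (@lebesgue_measure_tuple R n).

Definition shift_tuple n (a t : n.-tuple rT) : n.-tuple rT :=
  [tuple tnth t i + tnth a i | i < n].

Lemma measurable_shift_tuple n (a : n.-tuple rT) :
  measurable_fun setT (shift_tuple a).
Proof.
apply/measurable_fun_tnthP => i.
rewrite (_ : _ \o _ = (fun t : n.-tuple rT => tnth t i + tnth a i)); last first.
  by apply/funext => t /=; rewrite tnth_mktuple.
by apply: measurable_funD => //; exact: measurable_tnth.
Qed.

Lemma lebesgue_measure_shift (a : R) (A : set rT) : measurable A ->
  lebesgue_measure ((fun x : rT => x + a) @^-1` A) = lebesgue_measure A.
Proof.
move=> mA.
have ms : measurable_fun [set: rT] (fun x : rT => x + a : rT).
  by apply: measurable_funD.
pose P : {measure set rT -> \bar R} :=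
  measure_function_pushforward__canonical__measure_function_Measure
    (@lebesgue_measure R) ms.
rewrite [RHS](@lebesgue_measure_unique _ P)// => X [[c d] _ <-] /=.
rewrite /pushforward (_ : _ @^-1` _ = `]c - a, d - a]%classic); last first.
  by apply/seteqP; split => x /=; rewrite !in_itv /= ltrBlDr lerBrDr.
rewrite !lebesgue_measure_itv /= !lte_fin ltrD2r.
by case: ifP => // _; rewrite -!EFinB; congr EFin; ring.
Qed.

(** By induction on the dimension: a translation acts separately on the two factors, and the
    pushforward agrees with the product measure on rectangles, which determine it. *)
Lemma lebesgue_measure_tuple_shift n (a : n.-tuple rT) (A : set (n.-tuple rT)) :
  measurable A -> leb n (shift_tuple a @^-1` A) = leb n A.
Proof.
elim: n a A => [|n IH] a A mA.
  congr (_ _); apply/seteqP; split => t /=; rewrite (tuple0 t);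
    by rewrite (tuple0 (shift_tuple _ _)).
pose S (z : rT * n.-tuple rT) : rT * n.-tuple rT :=
  (z.1 + thead a, shift_tuple [tuple of behead a] z.2).
have mS : measurable_fun setT S.
  apply/measurable_fun_pair.
    by apply: measurable_funD => //; exact: measurable_fst.
  by apply: measurableT_comp; [exact: measurable_shift_tuple|exact: measurable_snd].
pose P : {measure set (rT * n.-tuple rT) -> \bar R} :=
  measure_function_pushforward__canonical__measure_function_Measure
    (lebesgue_measure \x leb n)%E mS.
rewrite /= /pushforward.
have -> : @tuple_of_pair R n @^-1` (shift_tuple a @^-1` A) =
    S @^-1` (@tuple_of_pair R n @^-1` A).
  apply/seteqP; split => -[x t] /=; congr (A _).
    apply: eq_from_tnth => i; rewrite tnth_mktuple.
    have [j ->|->] := unliftP ord0 i.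
      rewrite !tnthS tnth_mktuple; congr (_ + _).
      by rewrite [in LHS](tuple_eta a) tnthS.
    by rewrite [in LHS](tuple_eta a).
  apply: eq_from_tnth => i; rewrite tnth_mktuple.
  have [j ->|->] := unliftP ord0 i.
    rewrite !tnthS tnth_mktuple; congr (_ + _).
    by rewrite [in RHS](tuple_eta a) tnthS.
  by rewrite [in RHS](tuple_eta a).
have mB : measurable (@tuple_of_pair R n @^-1` A).
  rewrite -[X in measurable X]setTI.
  exact: (@measurable_tuple_of_pair R n measurableT).
rewrite [RHS](@product_measure_unique _ _ _ _ _ _ _ P)//.
move=> B C mB' mC; rewrite /P /= /pushforward.
rewrite (_ : S @^-1` _ = ((fun x : rT => x + thead a) @^-1` B) `*`
  (shift_tuple [tuple of behead a] @^-1` C))//.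
rewrite product_measure1E.
- by congr (_ * _)%E; [exact: lebesgue_measure_shift|exact: IH].
- rewrite -[X in measurable X]setTI.
  have : measurable_fun [set: rT] (fun x : rT => x + thead a : rT).
    by apply: measurable_funD.
  exact.
- by rewrite -[X in measurable X]setTI; exact: measurable_shift_tuple.
Qed.

Lemma integral_shift_tuple n (a : n.-tuple rT) (F : n.-tuple rT -> \bar R) :
  measurable_fun setT F -> (leb n).-integrable setT (F \o shift_tuple a) ->
  (\int[leb n]_t F (shift_tuple a t) = \int[leb n]_t F t)%E.
Proof.
move=> mF iF.
rewrite -(@integral_pushforward _ _ _ _ _ _ (measurable_shift_tuple a)
  (leb n) setT F)// ?preimage_setT//.
apply: eq_measure_integral; first exact: measurable_shift_tuple.
by move=> ? A mA _; exact: lebesgue_measure_tuple_shift.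
Qed.

End translation.

(** * Measurability of continuous functions *)

Section continuous_integrands.
Context {R : realType} {n : nat}.
Local Notation rT := (measurableTypeR R).
Local Notation leb := (@lebesgue_measure_tuple R n).
Implicit Types (u : 'rV[R]_n -> R) (x z : 'rV[R]_n).

Definition cube z (r : R) : set (n.-tuple rT) :=
  [set t | `|row_of_tuple t - z| <= r].

Lemma measurable_cube z (r : R) : measurable (cube z r).
Proof.
rewrite /cube.
have [r0|r0] := ltP r 0.
  rewrite (_ : [set _ | _] = set0)//; apply/seteqP; split => // t /= tr.
  by have := normr_ge0 (row_of_tuple t - z); rewrite leNgt (le_lt_trans tr r0).
rewrite (_ : [set _ | _] = \bigcap_(i in [set: 'I_n])
    ((fun t : n.-tuple rT => tnth t i) @^-1` `[z 0 i - r, z 0 i + r]%classic)).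
  apply: fin_bigcap_measurable => // i _; rewrite -[X in measurable X]setTI.
  by apply: (@measurable_tnth _ rT n i) => //; exact: measurable_itv.
apply/seteqP; split => t /=.
  move/(norm_leP _ r0) => H i _; rewrite /= in_itv /=.
  by have := H i; rewrite !mxE ler_distl.
move=> H; apply/norm_leP => // i.
by rewrite !mxE ler_distl; have := H i I; rewrite /= in_itv.
Qed.

Lemma lebesgue_measure_cube z (r : R) : 0 <= r ->
  leb (cube z r) = ((2 * r) ^+ n)%:E.
Proof.
move=> r0; rewrite /cube.
rewrite (_ : [set _ | _] =
    [set t | forall i, `[z 0 i - r, z 0 i + r]%classic (tnth t i)]).
  rewrite (@lebesgue_measure_tuple_box R n
    (fun i => `[z 0 i - r, z 0 i + r]%classic)); last first.
    by move=> i; exact: measurable_itv.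
  rewrite (eq_bigr (fun=> (2 * r)%:E)).
    by rewrite big_const_ord; elim: (n) => //= m ->; rewrite exprS.
  move=> i _; rewrite lebesgue_measure_itv /= lte_fin -EFinB.
  have [h|] := ltP (z 0 i - r) (z 0 i + r); first by congr EFin; ring.
  by move=> h; congr EFin; lra.
apply/seteqP; split => t /=.
  move/(norm_leP _ r0) => H i; rewrite /= in_itv /=.
  by have := H i; rewrite !mxE ler_distl.
move=> H; apply/norm_leP => // i.
by rewrite !mxE ler_distl; have := H i; rewrite /= in_itv.
Qed.

(** This links the product sigma-algebra on tuples to the topology on row vectors: an open set is
    the countable union of the cubes with rational centre and radius 1/(k+1) that it contains.
    Taking 2/(k+1) < e lets such a cube around a point stay in its ball of radius [e]. *)
Lemma measurable_row_of_tuple_open (U : set 'rV[R]_n) : open U ->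
  measurable (@row_of_tuple R n @^-1` U).
Proof.
move=> oU.
pose Q (c : 'rV[rat]_n * nat) := [set t : n.-tuple rT |
  `|row_of_tuple t - map_mx ratr c.1| <= c.2.+1%:R^-1].
pose F c := if asbool (Q c `<=` @row_of_tuple R n @^-1` U) then Q c else set0.
rewrite (_ : _ @^-1` _ = \bigcup_c F c).
  apply: countable_bigcupT_measurable; first exact: countableP.
  by move=> c; rewrite /F; case: ifP => // _; exact: measurable_cube.
apply/seteqP; split => t /=; last first.
  by move=> [c _]; rewrite /F; case: ifPn => // /asboolP; exact.
move=> Ut.
have : nbhs (row_of_tuple t) U by exact: open_nbhs_nbhs.
move=> /nbhs_normP[e /= e0 He].
have [k ke] : exists k : nat, k.+1%:R^-1 < e / 2.
  have e20 : 0 < e / 2 by lra.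
  exists (Num.bound (e / 2)^-1).
  rewrite invf_plt ?posrE// (lt_le_trans (archi_boundP _))//.
    by rewrite invr_ge0 ltW.
  by rewrite ler_nat.
have kp : 0 < k.+1%:R^-1 :> R by rewrite invr_gt0.
have /choice[r Hr] : forall i, exists r : rat,
    `|row_of_tuple t 0 i - ratr r| <= k.+1%:R^-1.
  move=> i; have [|r] := @rat_in_itvoo R (row_of_tuple t 0 i - k.+1%:R^-1)
    (row_of_tuple t 0 i + k.+1%:R^-1); first by rewrite ltrD2l gt0_cp.
  rewrite in_itv /= => /andP[r1 r2]; exists r.
  by rewrite distrC ler_distl !ltW.
have Qt : Q (\row_i r i, k) t.
  by rewrite /Q /=; apply/norm_leP; [exact: ltW|move=> i; have := Hr i; rewrite !mxE].
exists (\row_i r i, k) => //; rewrite /F ifT//; apply/asboolP => s.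
rewrite /Q /= in Qt *; move=> Qs; apply: He => /=.
rewrite distrC.
have := ler_normD (row_of_tuple s - map_mx ratr (\row_i r i))
  (map_mx ratr (\row_i r i) - row_of_tuple t).
rewrite addrA subrK distrC => h; apply: le_lt_trans h _.
by rewrite [X in _ + X]distrC (le_lt_trans (lerD Qs Qt))// [e]splitr ltrD.
Qed.

Lemma measurable_row_of_tuple u : continuous u ->
  measurable_fun setT (u \o @row_of_tuple R n : n.-tuple rT -> R).
Proof.
move=> cu; apply: (measurability (@RGenOInfty.G R)).
  exact: RGenOInfty.measurableE.
move=> _ [_ [x ->] <-]; rewrite setTI comp_preimage.
apply: measurable_row_of_tuple_open; apply: open_comp => // y _; exact: cu.
Qed.

End continuous_integrands.

(** * Integration by parts without boundary terms *)

Section compactly_supported_integrands.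
Context {R : realType} {n : nat}.
Local Notation rT := (measurableTypeR R).
Local Notation leb := (@lebesgue_measure_tuple R n).
Implicit Types (u v w : 'rV[R]_n -> R) (x z : 'rV[R]_n).

Definition space_integral u : R := \int[leb]_t u (row_of_tuple t).

Definition compact_support u := exists r : R, forall x, r <= `|x| -> u x = 0.

Lemma continuous_cube_bound u z (r : R) : continuous u ->
  exists2 M : R, 0 <= M & forall x, `|x - z| <= r -> `|u x| <= M.
Proof.
move=> cu; have [r0|r0] := ltP r 0.
  exists 0 => // x xr.
  by have := normr_ge0 (x - z); rewrite leNgt (le_lt_trans xr r0).
have [|||c _ cmax] := @EVT_max_rV R n (fun x => `|u x|)
  [set x | `|x - z| <= r].
- by exists z; rewrite /= subrr normr0.
- exact: compact_cube.
- by apply: continuous_subspaceT => x; exact: (cvg_norm (cu x)).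
by exists `|u c| => // x xr; apply: cmax; rewrite inE.
Qed.

Lemma compact_support_bound u : continuous u -> compact_support u ->
  exists2 M : R, 0 <= M & forall x, `|u x| <= M.
Proof.
move=> cu [r ur]; have [M M0 HM] := continuous_cube_bound 0 r cu.
exists M => // x; have [xr|/ltW/ur->] := leP `|x| r; last by rewrite normr0.
by apply: HM; rewrite subr0.
Qed.

Lemma lebesgue_measure_cube_fin z (r : R) : (leb (cube z r) < +oo)%E.
Proof.
have [r0|r0] := ltP r 0; last by rewrite lebesgue_measure_cube// ltry.
rewrite (_ : cube z r = set0) ?measure0//; apply/seteqP; split => // t /= tr.
by have := normr_ge0 (row_of_tuple t - z); rewrite leNgt (le_lt_trans tr r0).
Qed.

Lemma integrable_cube u z (r : R) : continuous u ->
  leb.-integrable (cube z r) (EFin \o (u \o @row_of_tuple R n)).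
Proof.
move=> cu; have [M M0 HM] := continuous_cube_bound z r cu.
apply: measurable_bounded_integrable.
- exact: measurable_cube.
- exact: lebesgue_measure_cube_fin.
- by apply: measurable_funTS; exact: measurable_row_of_tuple.
- exists M; split; first exact: num_real.
  by move=> k Mk t tr; rewrite /= (le_trans (HM _ tr))// ltW.
Qed.

Lemma integrable_cube_restrict u z (r : R) : continuous u ->
  leb.-integrable setT (EFin \o ((u \o @row_of_tuple R n) \_ (cube z r))).
Proof.
move=> cu; have /integrable_mkcond := integrable_cube z r cu.
move=> /(_ (measurable_cube z r)); rewrite restrict_EFin.
exact.
Qed.

Lemma compact_support_restrict u : compact_support u ->
  exists r : R, (u \o @row_of_tuple R n) \_ (cube 0 r) = u \o @row_of_tuple R n.
Proof.
move=> [r ur]; exists r; apply/funext => t; rewrite /patch.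
case: ifPn => // /negP tr; rewrite /= ur//.
have [//|tr'] := leP r `|row_of_tuple t|.
by exfalso; apply: tr; rewrite inE /cube /= subr0 ltW.
Qed.

Lemma integrable_compact_support u : continuous u -> compact_support u ->
  leb.-integrable setT (EFin \o (u \o @row_of_tuple R n)).
Proof.
move=> cu /compact_support_restrict[r <-].
exact: integrable_cube_restrict.
Qed.

Lemma space_integral_sum m (F : 'I_m -> 'rV[R]_n -> R) :
  (forall i, continuous (F i)) -> (forall i, compact_support (F i)) ->
  space_integral (fun x => \sum_(i < m) F i x) =
  \sum_(i < m) space_integral (F i).
Proof.
move=> cF sF; elim: m F cF sF => [|m IH] F cF sF.
  rewrite big_ord0 /space_integral.
  under eq_Rintegral do rewrite big_ord0.
  by rewrite Rintegral_cst// mul0r.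
rewrite big_ord_recl -IH//.
rewrite -RintegralD//.
- by apply: eq_Rintegral => t _; rewrite big_ord_recl.
- exact: integrable_compact_support.
- apply: (@integrable_compact_support
    (fun x => \sum_(i < m) F (lift ord0 i) x)).
    by apply: (@class_C_continuous _ _ 0); apply: class_C_sum => i; exact: cF.
  have /choice[r Hr] := sF.
  exists (\big[Num.max/0]_(i < m.+1) r i) => x /bigmax_leP[_ xr].
  by apply: big1 => i _; apply: Hr; exact: xr.
Qed.

Lemma space_integralB u v : continuous u -> compact_support u ->
  continuous v -> compact_support v ->
  space_integral (fun x => u x - v x) = space_integral u - space_integral v.
Proof.
by move=> *; rewrite /space_integral RintegralB//;
  exact: integrable_compact_support.
Qed.

Lemma compact_supportMl u v : compact_support v ->
  compact_support (fun x => u x * v x).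
Proof. by move=> [r vr]; exists r => x /vr ->; rewrite mulr0. Qed.

Lemma compact_supportB u v : compact_support u -> compact_support v ->
  compact_support (fun x => u x - v x).
Proof.
move=> [r ur] [s vs]; exists (Num.max r s) => x.
by rewrite ge_max => /andP[/ur -> /vs ->]; rewrite subrr.
Qed.

Lemma compact_support_partial i u : compact_support u ->
  compact_support (partial i u).
Proof.
move=> [r ur]; exists (r + 1) => x xr.
rewrite /partial (@near_eq_derive _ _ _ u (cst 0)) ?derive_cst//.
near=> y; rewrite ur//.
have : `|x - y| < 1 by near: y; exact: (@cvgr_dist_lt _ _ _ _ _ _ _ cvg_id).
have := ler_normD (x - y) y; rewrite subrK.
by move: xr; lra.
Unshelve. all: by end_near. Qed.

Lemma compact_support_laplacian u : compact_support u ->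
  compact_support (laplacian u).
Proof.
move=> su; have /choice[r Hr] : forall i, compact_support (partial i (partial i u)).
  by move=> i; do 2 apply: compact_support_partial.
exists (\big[Num.max/0]_(i < n) r i) => x /bigmax_leP[_ xr].
by apply: big1 => i _; apply: Hr; exact: xr.
Qed.

(** By translation invariance the integral of u(x + h e_i) does not depend on [h]; differentiating
    under the integral sign at h = 0 gives the claim. *)
Lemma space_integral_partial i u (du : 'rV[R]_n -> R) :
  continuous u -> compact_support u -> continuous du ->
  (forall x, is_derive x (delta_mx 0 i) u (du x)) -> space_integral du = 0.
Proof.
move=> cu su cdu Du.
have sdu : compact_support du.
  rewrite (_ : du = partial i u); first exact: compact_support_partial.
  by apply/funext => x; rewrite (partialE (Du x)).
pose e : 'rV[R]_n := delta_mx 0 i.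
pose a (h : R) : n.-tuple rT := [tuple h * (j == i)%:R | j < n].
have shiftE h t : row_of_tuple (shift_tuple (a h) t) = h *: e + row_of_tuple t.
  by apply/rowP => j; rewrite !mxE !tnth_mktuple eqxx addrC.
pose f (h : R) (t : n.-tuple rT) := u (h *: e + row_of_tuple t).
have cuh (h : R) : continuous (fun x => u (h *: e + x)).
  move=> x; apply: (@continuous_comp _ _ _ (fun x => h *: e + x) u).
    exact: (cvgD (cvg_cst _) cvg_id).
  exact: cu.
have suh (h : R) : compact_support (fun x => u (h *: e + x)).
  have [r ur] := su; exists (r + `|h *: e|) => x xr; apply: ur.
  by have := ler_normD (h *: e + x) (- (h *: e)); rewrite addrAC subrr add0r normrN; lra.
have df (h : R) t : is_derive h 1 (f ^~ t) (du (h *: e + row_of_tuple t)).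
  by apply: is_derive_line; exact: Du.
have fE h : \int[leb]_t f h t = space_integral u.
  rewrite /space_integral /Rintegral; congr fine.
  under eq_integral do rewrite /f -shiftE.
  apply: (@integral_shift_tuple R n (a h)
    (EFin \o (u \o @row_of_tuple R n))).
    by apply/measurable_EFinP; exact: measurable_row_of_tuple.
  have := integrable_compact_support (cuh h) (suh h).
  apply: eq_integrable => // t _ /=; rewrite -shiftE//.
have [M M0 HM] := compact_support_bound cdu sdu.
have [r dur] := sdu.
(* For |h| < 1 the translates of [du] vanish outside the cube of radius r + 1, so one constant on
   that cube dominates them all. *)
pose G := ((fun=> M : R) \o @row_of_tuple R n) \_ (cube 0 (r + 1)).
have eN : `|e| <= 1.
  apply/norm_leP => // j; rewrite !mxE eqxx /=.
  by case: (j == i); rewrite ?normr1 ?normr0.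
have dfE h t : partial1of2 f h t = du (h *: e + row_of_tuple t).
  by rewrite partial1of2E derive_val.
have D : (fun h => \int[leb]_t f h t)^`()%classic 0 =
    \int[leb]_t partial1of2 f 0 t.
  apply: (@differentiation_under_integral R _ _ leb f setT measurableT 0 (-1) 1
    _ _ _ G).
  - by rewrite /= in_itv /=; lra.
  - by move=> h _; exact: integrable_compact_support (cuh h) (suh h).
  - by move=> h t _ _; case: (df h t).
  - by move=> t; rewrite /G /patch; case: ifP.
  - by apply: (@integrable_cube_restrict (fun=> M)); exact: cst_continuous.
  - move=> h t; rewrite /= in_itv /= => h1 _; rewrite dfE /G /patch.
    case: ifPn => [_|/negP tr]; first exact: HM.
    rewrite dur ?normr0//.
    have [tr'|tr'] := leP `|row_of_tuple t| (r + 1).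
      by exfalso; apply: tr; rewrite inE /cube /= subr0.
    have := ler_normD (h *: e + row_of_tuple t) (- (h *: e)).
    rewrite addrAC subrr add0r normrN normrZ.
    have : `|h| * `|e| <= 1.
      by rewrite -[1]mulr1; apply: ler_pM => //; rewrite ler_norml; lra.
    lra.
rewrite (_ : (fun h => _) = cst (space_integral u)) in D; last first.
  by apply/funext => h; rewrite fE.
rewrite derive1_cst in D; rewrite [RHS]D /space_integral.
by apply: eq_Rintegral => t _; rewrite dfE scale0r add0r.
Qed.

(** The difference of the integrands is the sum over [i] of the derivatives of v d_i phi - (d_i v)
    phi, each compactly supported through [phi], so each derivative has integral zero. *)
Lemma green v phi : class_C 2 v -> class_C 2 phi -> compact_support phi ->
  space_integral (fun x => v x * laplacian phi x) =
  space_integral (fun x => laplacian v x * phi x).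
Proof.
move=> Cv Cp sp.
have cv := class_C_continuous Cv; have cp := class_C_continuous Cp.
have cdv i := class_C_continuous (class_C_partial i Cv).
have cdp i := class_C_continuous (class_C_partial i Cp).
have cddv i := class_C_continuous (class_C_partial i (class_C_partial i Cv)).
have cddp i := class_C_continuous (class_C_partial i (class_C_partial i Cp)).
have cM (f g : 'rV[R]_n -> R) : continuous f -> continuous g ->
    continuous (fun x => f x * g x).
  by move=> cf cg x; exact: (cvgM (cf x) (cg x)).
have cB (f g : 'rV[R]_n -> R) : continuous f -> continuous g ->
    continuous (fun x => f x - g x).
  by move=> cf cg x; exact: (cvgB (cf x) (cg x)).
apply/eqP; rewrite -subr_eq0 -space_integralB; first last.
- exact: compact_supportMl.
- by apply: cM => //; exact: (class_C_continuous (class_C_laplacian Cv)).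
- by apply: compact_supportMl; exact: compact_support_laplacian.
- by apply: cM => //; exact: (class_C_continuous (class_C_laplacian Cp)).
pose F i x := v x * partial i (partial i phi) x -
              partial i (partial i v) x * phi x.
rewrite (_ : (fun _ => _) = fun x => \sum_(i < n) F i x); last first.
  by apply/funext => x; rewrite sumrB -mulr_sumr -mulr_suml.
rewrite space_integral_sum.
- rewrite big1// => i _.
  apply: (@space_integral_partial i
    (fun x => v x * partial i phi x - partial i v x * phi x)).
  + by apply: cB; apply: cM.
  + apply: compact_supportB; apply: compact_supportMl => //.
    exact: compact_support_partial.
  + by apply: cB; apply: cM.
  + move=> x.
    have d1 := class_C_is_derive i x Cv.
    have d2 := class_C_is_derive i x Cp.
    have d3 := class_C_is_derive i x (class_C_partial i Cv).
    have d4 := class_C_is_derive i x (class_C_partial i Cp).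
    have := is_deriveB (is_deriveM d1 d4) (is_deriveM d3 d2).
    rewrite (_ : F i x = (v x *: partial i (partial i phi) x +
        partial i phi x *: partial i v x) -
      (partial i v x *: partial i phi x +
        phi x *: partial i (partial i v) x)).
      exact.
    rewrite /F /GRing.scale /=.
    move: (partial i (partial i phi) x) (partial i (partial i v) x).
    move: (partial i phi x) (partial i v x) (phi x) (v x) => a b c d a' b'.
    ring.
- by move=> i; apply: cB; apply: cM.
- move=> i; apply: compact_supportB; apply: compact_supportMl => //.
  by do 2 apply: compact_support_partial.
Qed.

End compactly_supported_integrands.

(** * Positivity of supersolutions *)

Section truncated_powers.
Context {R : realType}.
Implicit Types (s t : R) (k : nat).

(** For [k = 0] this is the constant 1, not an indicator, since 0 ^+ 0 = 1; hence the successor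
    exponents in the lemmas on vanishing. *)
Definition pos_pow k s : R := Num.max s 0 ^+ k.

Lemma pos_pow_ge0 k s : 0 <= pos_pow k s.
Proof. by rewrite exprn_ge0// le_max lexx orbT. Qed.

Lemma pos_pow_pos k s : 0 <= s -> pos_pow k s = s ^+ k.
Proof. by move=> s0; rewrite /pos_pow max_l. Qed.

Lemma pos_pow_neg k s : s <= 0 -> pos_pow k.+1 s = 0.
Proof. by move=> s0; rewrite /pos_pow max_r// expr0n. Qed.

Lemma pos_powM k s : s * pos_pow k.+1 s = pos_pow k.+2 s.
Proof.
have [s0|/ltW s0] := leP 0 s; first by rewrite !pos_pow_pos// -exprS.
by rewrite !pos_pow_neg// mulr0.
Qed.

Lemma pos_pow_le k s t : 0 <= t -> s <= t -> pos_pow k s <= t ^+ k.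
Proof. by move=> t0 st; rewrite lerXn2r ?nnegrE ?ge_max ?st ?le_max ?lexx ?orbT. Qed.

Lemma continuous_pos_pow k : continuous (pos_pow k : R -> R).
Proof.
move=> s; apply: (@continuous_comp _ _ _ (fun s : R => Num.max s 0)
  (fun s : R => s ^+ k)); last exact: exprn_continuous.
apply: (@continuous_max _ _ (fun s : R => s) (fun=> 0)); first exact: cvg_id.
exact: cst_continuous.
Qed.

Lemma is_derive_pos_pow k s :
  is_derive s 1 (pos_pow k.+2) (k.+2%:R * pos_pow k.+1 s).
Proof.
have dX : is_derive s 1 (fun s : R => s ^+ k.+2) (k.+2%:R * s ^+ k.+1).
  split; first exact: exprn_derivable.
  by rewrite exp_derive /GRing.scale /= mulr1.
have [s0|s0|<-] := ltgtP 0 s.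
- rewrite pos_pow_pos ?ltW//; apply: near_eq_is_derive dX.
  near=> t; rewrite pos_pow_pos// ltW//; near: t; exact: (cvgr_gt s cvg_id).
- rewrite pos_pow_neg ?ltW// mulr0.
  apply: (@near_eq_is_derive _ _ _ (cst 0)).
  by near=> t; rewrite pos_pow_neg// ltW//; near: t; exact: (cvgr_lt s cvg_id).
- rewrite pos_pow_neg// mulr0.
  (* At the kink the difference quotient is [pos_pow k.+1 h], at most |h|^(k+1), which tends to
     0. *)
  have L : h^-1 *: ((pos_pow k.+2 \o shift 0) (h *: 1) - pos_pow k.+2 0)
      @[h --> 0^'] --> (0 : R).
    rewrite (_ : (fun h => _) = (fun h : R => h^-1 * pos_pow k.+2 h)); last first.
      by apply/funext => h /=; rewrite addr0 [pos_pow _ 0]pos_pow_neg// subr0 [_%:A]mulr1.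
    apply/cvgrPdist_le => e e0; near=> h; rewrite sub0r normrN.
    have h0 : h != 0 by near: h; exact: nbhs_dnbhs_neq.
    rewrite -pos_powM mulKf// ger0_norm ?pos_pow_ge0//.
    have he : `|h| < Num.min 1 e.
      near: h; apply: dnbhs0_lt; by rewrite lt_min ltr01.
    apply: le_trans (pos_pow_le _ (normr_ge0 h) (ler_norm h)) _.
    move: he; rewrite lt_min => /andP[h1 he].
    by rewrite exprS (le_trans _ (ltW he))// ler_piMr// exprn_ile1// ltW.
  by split; [apply/cvg_ex; exists 0|exact: cvg_lim L].
Unshelve. all: by end_near. Qed.

End truncated_powers.

(** * Truncated paraboloids as weights *)

Section bumps.
Context {R : realType} {n : nat}.
Local Notation rT := (measurableTypeR R).
Local Notation leb := (@lebesgue_measure_tuple R n).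
Implicit Types (u v w : 'rV[R]_n -> R) (x z : 'rV[R]_n) (T : R).

(** The parameter [T] is the square of the radius of the support: differentiating in [T] then gives
    the same kind of function with a lower exponent. *)
Definition bump k T z x : R := pos_pow k (T - sqdist z x).

Lemma is_derive_bump_radial k T (s : R) :
  is_derive s 1 (fun s => pos_pow k.+2 (T - s))
    (- (k.+2%:R * pos_pow k.+1 (T - s))).
Proof.
rewrite -mulrN1.
apply: (@is_derive1_comp _ (pos_pow k.+2) (fun s => T - s)).
  exact: is_derive_pos_pow.
have := is_deriveB (is_derive_cst T s (1 : R)) (is_derive_id s (1 : R)).
by rewrite sub0r.
Qed.

Lemma continuous_bump k T z : continuous (bump k T z).
Proof.
move=> x; apply: (@continuous_comp _ _ _ (fun x => T - sqdist z x) (pos_pow k)).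
  exact: (cvgB (cvg_cst _) (@continuous_sqdist _ _ z x)).
exact: continuous_pos_pow.
Qed.

(** A truncated power of exponent j + 1 is [j] times continuously differentiable. Each derivative
    lowers [j], and the remaining [k.+1] ensures that at least one power, hence continuity, survives
    at the end. *)
Lemma class_C_bump j k T z : class_C j (bump (j + k.+1) T z).
Proof.
elim: j => [|j IH]; first exact: continuous_bump.
apply: (@class_C_intro _ _ j _ (fun i x =>
  - ((j + k.+1).+1%:R * bump (j + k.+1) T z x) * (2 * (x 0 i - z 0 i)))).
- exact: continuous_bump.
- move=> i x; rewrite addSn /bump addnS.
  apply: (@is_derive_radial _ _ z x i (fun s => pos_pow (j + k).+2 (T - s))).
  exact: is_derive_bump_radial.
- move=> i; apply: class_CM.
    rewrite (_ : (fun _ => _) =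
      (fun x => - (j + k.+1).+1%:R * bump (j + k.+1) T z x)); last first.
      by apply/funext => x; rewrite mulNr.
    by apply: class_CM => //; exact: class_C_cst.
  apply: class_CM; first exact: class_C_cst.
  by apply: class_CD; [exact: class_C_coord|exact: class_C_cst].
Qed.

(** The radial formula yields a factor |x-z|^2; writing it as T - (T - |x-z|^2) turns everything
    into bumps again. *)
Lemma laplacian_bump k T z x : laplacian (bump k.+3 T z) x =
  4 * k.+3%:R * k.+2%:R * T * bump k.+1 T z x -
  (4 * k.+3%:R * k.+2%:R + 2 * n%:R * k.+3%:R) * bump k.+2 T z x.
Proof.
have d1 y := is_derive_bump_radial k.+1 T (sqdist z y).
have d2 y : is_derive (sqdist z y) 1 (fun s => - (k.+3%:R * pos_pow k.+2 (T - s)))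
    (k.+3%:R * (k.+2%:R * pos_pow k.+1 (T - sqdist z y))).
  have := is_deriveN (is_deriveZ k.+3%:R
    (is_derive_bump_radial k T (sqdist z y))).
  by rewrite /GRing.scale /= mulrN opprK.
rewrite (@laplacian_radial _ _ z (fun s => pos_pow k.+3 (T - s))
  (fun s => - (k.+3%:R * pos_pow k.+2 (T - s)))
  (fun s => k.+3%:R * (k.+2%:R * pos_pow k.+1 (T - s))) d1 d2).
rewrite /bump -(pos_powM k); ring.
Qed.

(** As S >= 1, |x-z| > S implies |x-z|^2 >= S >= T; no square root of [T] is needed to locate the
    support. *)
Lemma bump_outside k T z x (S : R) : 1 <= S -> T <= S -> S < `|x - z| ->
  bump k.+1 T z x = 0.
Proof.
move=> S1 TS xS; apply: pos_pow_neg; rewrite subr_le0.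
apply: le_trans (norm_sqr_le_sqdist x z).
rewrite expr2 (le_trans TS)// (le_trans (ltW xS))// ler_peMr//.
by rewrite (le_trans S1)// ltW.
Qed.

Lemma bump_le k T z x : 0 <= T -> bump k T z x <= T ^+ k.
Proof.
by move=> T0; apply: pos_pow_le => //; rewrite gerBl sqdist_ge0.
Qed.

Lemma compact_support_bump k T z : compact_support (bump k.+1 T z).
Proof.
exists (`|T| + 1 + 1 + `|z|) => x xr; apply: (@bump_outside _ _ _ _ (`|T| + 1)).
- by rewrite lerDr.
- by rewrite (le_trans (ler_norm T))// lerDl.
- have := ler_normD (x - z) z; rewrite subrK; lra.
Qed.

(** A substitute for the integral of [v] over the ball of squared radius [T]. For constant [v] and T
    > 0 it is a multiple of T^(k + n/2), the normalization used below. *)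
Definition weighted_integral v z k T := space_integral (fun x => v x * bump k T z x).

Lemma is_derive_weighted_integral v z k T : continuous v ->
  is_derive T 1 (weighted_integral v z k.+2)
    (k.+2%:R * weighted_integral v z k.+1 T).
Proof.
move=> cv.
pose f T' (t : n.-tuple rT) := v (row_of_tuple t) * bump k.+2 T' z (row_of_tuple t).
have dpp (T' q : R) : is_derive T' 1 (fun T => pos_pow k.+2 (T - q))
    (k.+2%:R * pos_pow k.+1 (T' - q)).
  rewrite -[X in is_derive _ _ _ X]mulr1.
  apply: (@is_derive1_comp _ (pos_pow k.+2) (fun T => T - q)).
    exact: is_derive_pos_pow.
  exact: is_derive_shift.
have df T' t : is_derive T' 1 (f ^~ t) (k.+2%:R *
    (v (row_of_tuple t) * bump k.+1 T' z (row_of_tuple t))).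
  rewrite mulrCA; exact: is_deriveZ.
have dfE T' t := @derive_val _ _ _ _ _ _ _ (df T' t).
pose S := `|T| + 1.
have S1 : 1 <= S by rewrite lerDr.
pose G := (((fun x => `|v x| * (k.+2%:R * S ^+ k.+1)) \o @row_of_tuple R n))
  \_ (cube z S).
have cvb j T' : continuous (fun x => v x * bump j T' z x).
  by move=> x; exact: (cvgM (cv x) (continuous_bump (x := x))).
have intf T' : leb.-integrable setT (EFin \o f T').
  apply: (integrable_compact_support (cvb k.+2 T')).
  by apply: compact_supportMl; exact: compact_support_bump.
have IT : `]T - 1, T + 1[%classic T by rewrite /= in_itv /=; lra.
have intG : leb.-integrable setT (EFin \o G).
  apply: (@integrable_cube_restrict _ _ (fun x => `|v x| * (k.+2%:R * S ^+ k.+1))).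
  move=> x; exact: (cvgM (cvg_norm (cv x)) (cvg_cst _)).
have G0 t : 0 <= G t.
  rewrite /G /patch; case: ifP => // _ /=.
  by rewrite !mulr_ge0// exprn_ge0//; lra.
have GB T' t : `]T - 1, T + 1[%classic T' -> setT t ->
    `|partial1of2 f T' t| <= G t.
  rewrite /= in_itv /= => T'T _; rewrite partial1of2E dfE /G /patch.
  have T'S : T' <= S by have := ler_norm T; rewrite /S; lra.
  case: ifPn => [_|/negP tr].
    rewrite /= !normrM mulrCA ler_wpM2l// [X in X * _]ger0_norm// ler_wpM2l//.
    rewrite ger0_norm ?pos_pow_ge0// /bump; apply: pos_pow_le; first by lra.
    by have := sqdist_ge0 z (row_of_tuple t); lra.
  rewrite (bump_outside _ S1 T'S) ?mulr0 ?normr0// ltNge; apply/negP => h.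
  by apply: tr; rewrite inE.
have der T' t (_ : `]T - 1, T + 1[%classic T') (_ : setT t) :
    derivable (f ^~ t) T' 1 by case: (df T' t).
split.
  exact: (@derivable_under_integral R _ _ leb f setT measurableT T (T - 1)
    (T + 1) IT (fun T' _ => intf T') der G G0 intG GB).
rewrite -derive1E.
have := @differentiation_under_integral R _ _ leb f setT measurableT T (T - 1)
    (T + 1) IT (fun T' _ => intf T') der G G0 intG GB.
rewrite /weighted_integral /space_integral /f => ->.
rewrite -RintegralZl//; last first.
  apply: (integrable_compact_support (cvb k.+1 T)).
  by apply: compact_supportMl; exact: compact_support_bump.
apply: eq_Rintegral => t _.
by rewrite -[LHS]/(partial1of2 f T t) partial1of2E dfE.
Qed.

End bumps.

(** * Monotone means and the sign of supersolutions *)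

Section superharmonic_means.
Context {R : realType} {n : nat}.
Local Notation rT := (measurableTypeR R).
Local Notation leb := (@lebesgue_measure_tuple R n).
Implicit Types (u v w : 'rV[R]_n -> R) (x z : 'rV[R]_n) (T : R).

Lemma bump_ge0 k T z x : 0 <= bump k T z x.
Proof. exact: pos_pow_ge0. Qed.

Lemma class_C2_bump k T z : class_C 2 (@bump R n k.+3 T z).
Proof. exact: (@class_C_bump R n 2 k). Qed.

Lemma weighted_integral_laplacian v z k T : class_C 2 v ->
  space_integral (fun x => laplacian v x * bump k.+3 T z x) =
  4 * k.+3%:R * k.+2%:R * T * weighted_integral v z k.+1 T -
  (4 * k.+3%:R * k.+2%:R + 2 * n%:R * k.+3%:R) * weighted_integral v z k.+2 T.
Proof.
move=> Cv.
rewrite -(green Cv (@class_C2_bump k T z) (@compact_support_bump R n k.+2 T z)).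
have cv := class_C_continuous Cv.
have cvb j : continuous (fun x => v x * bump j T z x).
  by move=> x; exact: (cvgM (cv x) (continuous_bump (x := x))).
have ivb j : leb.-integrable setT
    (EFin \o ((fun x => v x * bump j.+1 T z x) \o @row_of_tuple R n)).
  apply: integrable_compact_support (cvb _) _.
  by apply: compact_supportMl; exact: compact_support_bump.
rewrite /weighted_integral /space_integral -!RintegralZl//.
rewrite -RintegralB//.
- apply: eq_Rintegral => t _; rewrite laplacian_bump.
  move: (bump k.+1 T z _) (bump k.+2 T z _) (v _) => a b c; ring.
- have := @integrableZl _ _ _ leb _ measurableT
    (4 * k.+3%:R * k.+2%:R * T) _ (ivb k).
  by apply: eq_integrable.
- have := @integrableZl _ _ _ leb _ measurableT
    (4 * k.+3%:R * k.+2%:R + 2 * n%:R * k.+3%:R) _ (ivb k.+1).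
  by apply: eq_integrable.
- exact: (ivb k.+1).
- exact: (ivb k).
Qed.

Lemma space_integral_le0 u : continuous u -> compact_support u ->
  (forall x, u x <= 0) -> space_integral u <= 0.
Proof.
move=> cu su u0; rewrite -oppr_ge0 /space_integral -mulN1r -RintegralZl//.
  by apply: Rintegral_ge0 => t _; rewrite mulN1r oppr_ge0.
exact: integrable_compact_support.
Qed.

(** Write A_k for the integral with exponent [k]. Then A_3' = 3 A_2, while Green's identity against
    the bump of exponent 4 gives 48 T A_2 <= (48 + 8n) A_3, that is T A_3' <= (3 + n/2) A_3. So A_3
    divided by its value for constants, up to a factor, does not increase. *)
Lemma superharmonic_weighted_integral_nincr v z : class_C 2 v ->
  (forall x, laplacian v x <= 0) -> forall S T, 0 < S -> S <= T ->
  weighted_integral v z 3 T * T `^ (- (3 + n%:R / 2)) <=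
  weighted_integral v z 3 S * S `^ (- (3 + n%:R / 2)).
Proof.
move=> Cv Lv S T S0 ST.
have cv := class_C_continuous Cv.
pose k : R := 3 + n%:R / 2.
pose f T := weighted_integral v z 3 T * T `^ (- k).
have df T' : 0 < T' -> is_derive T' 1 f
    (weighted_integral v z 3 T' * (- k * T' `^ (- k - 1)) +
     T' `^ (- k) * (3%:R * weighted_integral v z 2 T')).
  move=> T'0.
  have d1 := is_derive_weighted_integral z 1 T' cv.
  have d2 := is_derive1_powR (- k) T'0.
  exact: (is_deriveM d1 d2).
have [E|ST'] := eqVneq S T; first by rewrite E.
have {ST'}ST' : S < T by rewrite lt_neqAle ST'.
apply: (@ler0_derive1_nincr R f S T) => //.
- by move=> x; rewrite in_itv /= => /andP[Sx _]; case: (df x (lt_trans S0 Sx)).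
- move=> x; rewrite in_itv /= => /andP[Sx _]; have x0 := lt_trans S0 Sx.
  rewrite derive1E (@derive_val _ _ _ _ _ _ _ (df x x0)).
  have -> : x `^ (- k) = x * x `^ (- k - 1).
    rewrite -[X in X * _](powRr1 (ltW x0)) -powRD; last by rewrite (gt_eqF x0) implybT.
    by congr (_ `^ _); ring.
  have P0 : 0 < x `^ (- k - 1) by exact: powR_gt0.
  suff : x * (3%:R * weighted_integral v z 2 x) <= k * weighted_integral v z 3 x.
    move=> h; have : 0 <= x `^ (- k - 1) * (k * weighted_integral v z 3 x -
        x * (3%:R * weighted_integral v z 2 x)).
      by rewrite mulr_ge0 ?(ltW P0)// subr_ge0.
    lra.
  have := weighted_integral_laplacian z 1 x Cv.
  have : space_integral (fun y => laplacian v y * bump 4 x z y) <= 0.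
    apply: space_integral_le0.
    + move=> y.
      have := class_C_continuous (class_C_laplacian Cv) (x := y).
      move=> c; exact: (cvgM c (continuous_bump (x := y))).
    + by apply: compact_supportMl; exact: compact_support_bump.
    + by move=> y; rewrite mulr_le0_ge0// pos_pow_ge0.
  move=> h E; move: h; rewrite E /k; lra.
- apply: derivable_within_continuous => x; rewrite in_itv /= => /andP[Sx _].
  by case: (df x (lt_le_trans S0 Sx)).
Qed.

(* If v z < 0, monotonicity of the means of v forces the means of u to grow
   like the square of the radius. *)
Lemma supersolution_ge0 (lambda : R) u z : (0 < n)%N -> class_C 4 u ->
  (forall x, 0 <= u x) -> 0 <= lambda ->
  (forall x, laplacian (fun y => lambda * u y - laplacian u y) x <= 0) ->
  (exists C : R, forall r : R, 1 <= r ->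
     \int[leb]_(t in cube z r) u (row_of_tuple t) <= C * r ^+ n) ->
  0 <= lambda * u z - laplacian u z.
Proof.
move=> n0 Cu u0 l0 Lv [C HC].
pose v x := lambda * u x - laplacian u x.
have Cu2 : class_C 2 u by do 2 apply: class_CW.
have Cv : class_C 2 v.
  apply: class_CD; first by apply: class_CM; [exact: class_C_cst|exact: Cu2].
  rewrite (_ : (fun _ => _) = (fun x => (-1) * laplacian u x)).
    by apply: class_CM; [exact: class_C_cst|exact: class_C_laplacian].
  by apply/funext => x; rewrite mulN1r.
have cv := class_C_continuous Cv; have cu := class_C_continuous Cu.
have cLu := class_C_continuous (class_C_laplacian Cu2).
have vE x : v x = lambda * u x - laplacian u x by [].
have {}Lv x : laplacian v x <= 0 by exact: Lv.
rewrite -vE leNgt; clearbody v; apply/negP => vz0.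
have cM (f g : 'rV[R]_n -> R) : continuous f -> continuous g -> continuous (fun x => f x * g x).
  by move=> cf cg x; exact: (cvgM (cf x) (cg x)).
have sM (f : 'rV[R]_n -> R) k T : compact_support (fun x => f x * bump k.+1 T z x).
  by apply: compact_supportMl; exact: compact_support_bump.
have iM (f : 'rV[R]_n -> R) k T : continuous f -> leb.-integrable setT
    (EFin \o ((fun x => f x * bump k.+1 T z x) \o @row_of_tuple R n)).
  move=> cf; apply: integrable_compact_support; last exact: sM.
  by apply: (cM); [exact: cf|exact: continuous_bump].
have [T0 T00 HT0] : exists2 T0, 0 < T0 & forall x, sqdist z x < T0 -> v x < v z / 2.
  have : \forall x \near z, v x < v z / 2 by apply: (cvgr_lt (v z) (cv z)); lra.
  move=> /nbhs_normP[e /= e0 He]; exists (e ^+ 2); first exact: exprn_gt0.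
  move=> x xe; apply: He; rewrite /= distrC.
  rewrite -ltr_sqr ?nnegrE ?normr_ge0 ?(ltW e0)//.
  exact: le_lt_trans (norm_sqr_le_sqdist x z) xe.
have A30 : weighted_integral v z 3 T0 < 0.
  pose nr : R := n%:R; have nr0 : 0 < nr by rewrite ltr0n.
  (* As s <= 1, the cube of radius [s] has squared distances at most n s^2 <= n s <= T0/2. There the
     bump is at least (T0/2)^3 and v < v z / 2; elsewhere in the support [v] is still negative. *)
  pose s := Num.min 1 (T0 / (2 * nr)).
  have s0 : 0 < s by rewrite lt_min ltr01 divr_gt0// mulr_gt0.
  have sT : nr * s ^+ 2 <= T0 / 2.
    rewrite expr2 (@le_trans _ _ (nr * s))//.
      rewrite ler_pM2l//; apply: ler_piMl; first exact: ltW.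
      by rewrite ge_min lexx.
    rewrite mulrC -ler_pdivlMr// (_ : T0 / 2 / nr = T0 / (2 * nr)).
      by rewrite ge_min lexx orbT.
    by field; rewrite gt_eqF.
  pose a := v z / 2 * (T0 / 2) ^+ 3.
  have a0 : a < 0 by rewrite pmulr_llt0 ?exprn_gt0//; lra.
  apply: (@le_lt_trans _ _ (\int[leb]_(t in cube z s) a)); last first.
    rewrite Rintegral_cst; last exact: measurable_cube.
    rewrite [X in fine X](lebesgue_measure_cube z (ltW s0)) /= pmulr_llt0//.
    by rewrite exprn_gt0// mulr_gt0.
  rewrite Rintegral_mkcond; apply: le_Rintegral => //.
  - exact: iM.
  - by apply: (@integrable_cube_restrict R n (fun=> a)); exact: cst_continuous.
  move=> t _; rewrite /patch; case: ifPn => [|_].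
    rewrite inE => ts.
    have qs : sqdist z (row_of_tuple t) <= T0 / 2.
      apply: le_trans (sqdist_le_norm _ _) _; apply: le_trans sT.
      by rewrite ler_pM2l// ler_sqr ?nnegrE// ltW.
    have vt : v (row_of_tuple t) < v z / 2 by apply: HT0; lra.
    have bt : (T0 / 2) ^+ 3 <= bump 3 T0 z (row_of_tuple t).
      rewrite /bump; move: (sqdist z _) qs => q qs.
      have Tq : T0 / 2 <= T0 - q by lra.
      have T20 : 0 <= T0 / 2 by lra.
      rewrite pos_pow_pos; last exact: le_trans Tq.
      by apply: lerXn2r; rewrite ?nnegrE //; exact: le_trans Tq.
    rewrite /a; move: (v (row_of_tuple t)) (bump 3 T0 z _) vt bt => a1 b1 vt bt.
    apply: (@le_trans _ _ (v z / 2 * b1)).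
      rewrite ler_wpM2r ?(ltW vt)//; apply: le_trans bt.
      by rewrite exprn_ge0//; lra.
    by rewrite ler_wnM2l//; lra.
  have [qT|qT] := ltP (sqdist z (row_of_tuple t)) T0.
    rewrite mulr_le0_ge0// ?pos_pow_ge0//.
    by have := HT0 _ qT; lra.
  by rewrite /bump pos_pow_neg ?mulr0// subr_le0.
(* The part lambda u of [v] contributes a nonnegative amount. In the other part the Laplacian is
   moved onto the bump of exponent 3, where it is at most 24 T (T - |x-z|^2)_+ <= 24 T^2, with 24 =
   4 * 3 * 2. The support lies in the cube of radius sqrt T, where the growth hypothesis gives |C|
   T^(n/2). *)
have Alow T : 1 <= T -> - (24%:R * `|C| * T ^+ 2 * T `^ (n%:R / 2)) <=
    weighted_integral v z 3 T.
  move=> T1; have T0' : 0 <= T by lra.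
  have -> : weighted_integral v z 3 T =
      space_integral (fun x => lambda * u x * bump 3 T z x) -
      space_integral (fun x => laplacian u x * bump 3 T z x).
    rewrite -space_integralB.
    - by congr space_integral; apply/funext => x; rewrite -mulrBl -vE.
    - apply: (cM); last exact: continuous_bump.
      by apply: (cM); [exact: cst_continuous|exact: cu].
    - exact: sM.
    - by apply: (cM); [exact: cLu|exact: continuous_bump].
    - exact: sM.
  rewrite -(green Cu2 (@class_C2_bump 0 T z) (@compact_support_bump R n 2 T z)).
  have I0 : 0 <= space_integral (fun x => lambda * u x * bump 3 T z x).
    by apply: Rintegral_ge0 => t _; rewrite mulr_ge0 ?bump_ge0// mulr_ge0.
  suff : space_integral (fun x => u x * laplacian (bump 3 T z) x) <=
    24%:R * `|C| * T ^+ 2 * T `^ (n%:R / 2) by lra.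
  pose r := Num.sqrt T.
  have r1 : 1 <= r by rewrite -[1]sqrtr1 ler_wsqrtr.
  have rn : r ^+ n = T `^ (n%:R / 2).
    by rewrite -powR_mulrn ?sqrtr_ge0// /r -powR12_sqrt// -powRrM mulrC.
  apply: (@le_trans _ _ (\int[leb]_(t in cube z r) (24%:R * T ^+ 2 * u (row_of_tuple t)))).
    rewrite [leRHS]Rintegral_mkcond; apply: le_Rintegral => //.
    - apply: (@integrable_compact_support R n
        (fun x => u x * laplacian (bump 3 T z) x)).
        apply: (cM _ _ cu).
        exact: (class_C_continuous (class_C_laplacian (@class_C2_bump 0 T z))).
      apply: compact_supportMl; apply: compact_support_laplacian.
      exact: compact_support_bump.
    - apply: (@integrable_cube_restrict R n (fun x => 24%:R * T ^+ 2 * u x)).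
      by apply: (cM); [exact: cst_continuous|exact: cu].
    move=> t _; rewrite laplacian_bump /patch.
    have b10 := bump_ge0 1 T z (row_of_tuple t).
    have b20 := bump_ge0 2 T z (row_of_tuple t).
    have b1T := @bump_le R n 1 T z (row_of_tuple t) T0'.
    have ut := u0 (row_of_tuple t).
    apply: (@le_trans _ _ (24%:R * T * (u (row_of_tuple t) * bump 1 T z (row_of_tuple t)))).
      have : 0 <= (4 * 3%:R * 2%:R + 2 * n%:R * 3%:R) *
          bump 2 T z (row_of_tuple t) * u (row_of_tuple t).
        by rewrite mulr_ge0 ?ut// mulr_ge0// addr_ge0// !mulr_ge0.
      move: (bump 1 T z _) (bump 2 T z _) (u _) => b1 b2 ux h.
      lra.
    case: ifPn => [_|/negP tr].
      have -> : 24%:R * T ^+ 2 * u (row_of_tuple t) =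
          24%:R * T * (u (row_of_tuple t) * T ^+ 1).
        by move: (u _) => a; ring.
      have T24 : 0 <= 24%:R * T by apply: mulr_ge0.
      exact: (ler_wpM2l T24 (ler_wpM2l ut b1T)).
    rewrite /bump pos_pow_neg ?mulr0// subr_le0.
    apply: le_trans (norm_sqr_le_sqdist _ _).
    rewrite -[T]sqr_sqrtr// ler_sqr ?nnegrE ?sqrtr_ge0// leNgt.
    by apply/negP => h; apply: tr; rewrite inE /cube /= ltW.
  rewrite RintegralZl; [|exact: measurable_cube|exact: integrable_cube].
  have := HC r r1; rewrite rn => h.
  have -> : 24%:R * `|C| * T ^+ 2 * T `^ (n%:R / 2) =
    24%:R * T ^+ 2 * (`|C| * T `^ (n%:R / 2)) by ring.
  rewrite ler_wpM2l ?mulr_ge0 ?exprn_ge0//.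
  by rewrite (le_trans h)// ler_wpM2r ?powR_ge0// ler_norm.
pose k : R := 3 + n%:R / 2.
have mono T : T0 <= T -> weighted_integral v z 3 T * T `^ (- k) <=
    weighted_integral v z 3 T0 * T0 `^ (- k).
  by move=> ?; exact: superharmonic_weighted_integral_nincr.
pose c := - (weighted_integral v z 3 T0 * T0 `^ (- k)).
have c0 : 0 < c by rewrite oppr_gt0 pmulr_llt0 ?powR_gt0.
(* Multiplied by T^(1-k), the integral is at least - 24 |C| by [Alow] and at most - c T by
   monotonicity; this [T] makes the two incompatible. *)
pose T := Num.max (Num.max T0 1) ((24%:R * `|C| + 1) / c).
have TT0 : T0 <= T by rewrite !le_max lexx.
have T1 : 1 <= T by rewrite !le_max lexx orbT.
have T0' : 0 < T by lra.
have Tc : 24%:R * `|C| + 1 <= c * T by rewrite [c * T]mulrC -ler_pdivrMr// /T le_max lexx orbT.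
have := mono T TT0.
have P : 0 < T `^ (- k) by exact: powR_gt0.
have : - (24%:R * `|C|) <= weighted_integral v z 3 T * T `^ (- k) * T.
  have -> : 24%:R * `|C| = 24%:R * `|C| * T ^+ 2 * T `^ (n%:R / 2) * T `^ (- k) * T.
    have -> : 24%:R * `|C| * T ^+ 2 * T `^ (n%:R / 2) * T `^ (- k) * T =
      24%:R * `|C| * (T ^+ 3 * T `^ (n%:R / 2) * T `^ (- k)) by ring.
    rewrite -powR_mulrn ?(ltW T0')// -powRD; last by rewrite (gt_eqF T0') implybT.
    rewrite -powRD; last by rewrite (gt_eqF T0') implybT.
    by rewrite /k subrr powRr0 mulr1.
  rewrite -[leLHS]mulNr -[X in X * T <= _]mulNr.
  exact: (ler_wpM2r (ltW T0') (ler_wpM2r (ltW P) (Alow T T1))).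
move=> h1 h2.
have h3 : weighted_integral v z 3 T * T `^ (- k) * T <= (- c) * T.
  by rewrite ler_pM2r// /c opprK.
by move: (le_trans h1 h3); lra.
Qed.

End superharmonic_means.

(** * Comparison with radial functions *)

Section radial_powers.
Context {R : realType} {n : nat}.
Implicit Types (x z : 'rV[R]_n) (c s : R).

(** One family, stable under differentiation up to polynomial factors, provides both the barrier for
    superharmonic functions ([c] = rho^-2) and the explicit solution ([c] = 1). *)
Definition radial_power c s z x : R := (1 + c * sqdist z x) `^ (- s).

Lemma radial_power_base_ge1 c z x : 0 <= c -> 1 <= 1 + c * sqdist z x.
Proof. by move=> c0; rewrite lerDl mulr_ge0// sqdist_ge0. Qed.

Lemma is_derive_affine_power c s (q : R) : 0 < 1 + c * q ->
  is_derive q 1 (fun q => (1 + c * q) `^ (- s))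
    (- (s * c) * (1 + c * q) `^ (- (s + 1))).
Proof.
move=> h0.
have -> : - (s * c) * (1 + c * q) `^ (- (s + 1)) =
    - s * (1 + c * q) `^ (- s - 1) * c.
  by rewrite opprD; ring.
apply: (@is_derive1_comp _ (fun h => h `^ (- s)) (fun q => 1 + c * q)).
  exact: is_derive1_powR.
have := is_deriveD (is_derive_cst (1 : R) q (1 : R))
  (is_deriveZ c (is_derive_id q (1 : R))).
by rewrite /GRing.scale /= mulr1 add0r.
Qed.

Lemma is_derive_radial_power c s z x i : 0 <= c ->
  is_derive x (delta_mx 0 i) (radial_power c s z)
    (- (s * c) * radial_power c (s + 1) z x * (2 * (x 0 i - z 0 i))).
Proof.
move=> c0.
apply: (@is_derive_radial _ _ z x i (fun q => (1 + c * q) `^ (- s))).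
apply: is_derive_affine_power.
by rewrite (lt_le_trans ltr01)// radial_power_base_ge1.
Qed.

Lemma continuous_radial_power c s z : 0 <= c -> continuous (radial_power c s z).
Proof.
move=> c0 x.
have h0 : 0 < 1 + c * sqdist z x.
  by rewrite (lt_le_trans ltr01)// radial_power_base_ge1.
apply: (@continuous_comp _ _ _ (sqdist z) (fun q => (1 + c * q) `^ (- s))).
  exact: continuous_sqdist.
apply: differentiable_continuous; apply/derivable1_diffP.
by case: (is_derive_affine_power s h0).
Qed.

Lemma class_C_radial_power k c s z : 0 <= c -> class_C k (radial_power c s z).
Proof.
move=> c0; elim: k s => [|k IH] s; first exact: continuous_radial_power.
apply: (@class_C_intro _ _ k _ (fun i x =>
  - (s * c) * radial_power c (s + 1) z x * (2 * (x 0 i - z 0 i)))).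
- exact: continuous_radial_power.
- by move=> i x; exact: is_derive_radial_power.
- move=> i; apply: class_CM.
    by apply: class_CM; [exact: class_C_cst|exact: IH].
  apply: class_CM; first exact: class_C_cst.
  by apply: class_CD; [exact: class_C_coord|exact: class_C_cst].
Qed.

(** The factor c |x-z|^2 is rewritten as the base minus 1. The leading coefficient 2s + 2 - n
    vanishes at the decay |x|^(2-n) of the fundamental solution. *)
Lemma laplacian_radial_power c s z x : 0 <= c ->
  laplacian (radial_power c s z) x =
  2 * c * s * ((2 * s + 2 - n%:R) * radial_power c (s + 1) z x -
               2 * (s + 1) * radial_power c (s + 2) z x).
Proof.
move=> c0.
have h0 y : 0 < 1 + c * sqdist z y.
  by rewrite (lt_le_trans ltr01)// radial_power_base_ge1.
have d1 y := is_derive_affine_power s (h0 y).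
have d2 y : is_derive (sqdist z y) 1
    (fun q => - (s * c) * (1 + c * q) `^ (- (s + 1)))
    (s * (s + 1) * c ^+ 2 * (1 + c * sqdist z y) `^ (- (s + 2))).
  have := is_deriveZ (- (s * c)) (is_derive_affine_power (s + 1) (h0 y)).
  rewrite /GRing.scale /= (_ : s + 1 + 1 = s + 2); last by rewrite -addrA.
  move: (powR _ _) => e; congr is_derive; ring.
rewrite (@laplacian_radial _ _ z (fun q => (1 + c * q) `^ (- s))
  (fun q => - (s * c) * (1 + c * q) `^ (- (s + 1)))
  (fun q => s * (s + 1) * c ^+ 2 * (1 + c * q) `^ (- (s + 2))) d1 d2).
rewrite -/(radial_power c (s + 1) z x) -/(radial_power c (s + 2) z x).
have -> : radial_power c (s + 1) z x =
    (1 + c * sqdist z x) * radial_power c (s + 2) z x.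
  rewrite /radial_power -[X in _ = X * _]powRr1 ?(ltW (h0 x))// -powRD.
    by congr (_ `^ _); ring.
  by rewrite (gt_eqF (h0 x)) implybT.
move: (radial_power _ _ _ _) (sqdist z x) => e q; ring.
Qed.

End radial_powers.

Lemma natr_ge3 (R : realType) (n : nat) (x : R) :
  (3 <= n)%N -> x = n%:R -> 3 <= x.
Proof. by move=> n3 ->; rewrite ler_nat. Qed.

Section comparison.
Context {R : realType} {n : nat}.
Hypothesis n3 : (3 <= n)%N.
Implicit Types (u v w : 'rV[R]_n -> R) (x z : 'rV[R]_n).

Local Notation nr := (n%:R).
Let n0 : (0 < n)%N. Proof. exact: leq_trans n3. Qed.

Lemma sqdist_far z x (r : R) : 0 <= r -> r + `|z| <= `|x| -> r ^+ 2 <= sqdist z x.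
Proof.
move=> r0 xr; apply: le_trans (norm_sqr_le_sqdist x z).
rewrite ler_sqr ?nnegrE//.
by have := ler_normD (x - z) z; rewrite subrK; lra.
Qed.

Lemma class_C_affine_sqdist k z (a b : R) :
  class_C k (fun x => a * sqdist z x + b).
Proof.
apply: class_CD; last exact: class_C_cst.
by apply: class_CM; [exact: class_C_cst|exact: class_C_sqdist].
Qed.

Lemma laplacian_affine_sqdist z (a b : R) x :
  laplacian (fun x => a * sqdist z x + b) x = 2 * nr * a.
Proof.
have d1 (q : R) : is_derive q 1 (fun q => a * q + b) a.
  have := is_deriveD (is_deriveZ a (is_derive_id q (1 : R)))
    (is_derive_cst b q (1 : R)).
  by rewrite /GRing.scale /= mulr1 addr0.
rewrite (@laplacian_radial _ _ z (fun q => a * q + b) (fun=> a) (fun=> 0)).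
by rewrite mulr0 add0r.
Qed.

(** The paraboloid has Laplacian - 2nk and is nonpositive outside the ball, so the difference can be
    negative only where the bound on the Laplacian of [v] is available. *)
Lemma paraboloid_lower_bound v z (k r : R) : class_C 2 v ->
  (forall x, 0 <= v x) -> 0 <= k -> 0 <= r ->
  (forall x, sqdist z x < r ^+ 2 -> laplacian v x <= - (2 * nr * k)) ->
  forall x, k * (r ^+ 2 - sqdist z x) <= v x.
Proof.
have nr3 := @natr_ge3 R n _ n3 erefl.
move=> Cv v0 k0 r0 Lv.
pose g x := k * sqdist z x + - (k * r ^+ 2).
have Cg : class_C 2 g by exact: class_C_affine_sqdist.
have gE x : g x = k * sqdist z x + - (k * r ^+ 2) by [].
have Lg x : laplacian g x = 2 * nr * k by exact: laplacian_affine_sqdist.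
clearbody g.
have : forall x, 0 <= v x + g x.
  apply: (@min_principle _ _ (fun x => v x + g x) n0 (class_CD Cv Cg)).
  - move=> x wx; rewrite (laplacianD x Cv Cg) Lg.
    suff /Lv : sqdist z x < r ^+ 2 by lra.
    rewrite ltNge; apply/negP => h.
    have := v0 x; have : 0 <= k * (sqdist z x - r ^+ 2) by rewrite mulr_ge0// subr_ge0.
    by move: wx; rewrite gE; lra.
  - move=> e e0; exists (r + `|z|) => x /(sqdist_far r0) h.
    have := v0 x; have : 0 <= k * (sqdist z x - r ^+ 2) by rewrite mulr_ge0// subr_ge0.
    by rewrite gE; lra.
by move=> H x; have := H x; rewrite gE; lra.
Qed.

(** The barrier is a (4 r^2 - |x-z|^2) with a r^2 = k = m / (2n + 4 lambda). It is at most 4k and,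
    as r >= 1 gives a <= k, its image under - Delta + lambda is at most m. On the ball of radius [r]
    it is at least 3k, a bound uniform in [r]. *)
Lemma resolvent_lower_bound u z (lambda m r : R) : class_C 2 u ->
  (forall x, 0 <= u x) -> 0 < lambda -> 0 <= m -> 1 <= r ->
  (forall x, sqdist z x < 4 * r ^+ 2 -> m <= lambda * u x - laplacian u x) ->
  forall x, sqdist z x <= r ^+ 2 -> 3 * m / (2 * nr + 4 * lambda) <= u x.
Proof.
have nr3 := @natr_ge3 R n _ n3 erefl.
move=> Cu u0 l0 m0 r1 Hm.
have r20 : 0 < r ^+ 2 by rewrite exprn_gt0//; lra.
have r21 : 1 <= r ^+ 2 by rewrite exprn_ege1.
have D0 : 0 < 2 * nr + 4 * lambda by lra.
pose k := m / (2 * nr + 4 * lambda).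
have kE : k * (2 * nr + 4 * lambda) = m by rewrite divfK// gt_eqF.
have k0 : 0 <= k by rewrite divr_ge0// ltW.
pose a := k / r ^+ 2.
have aE : a * r ^+ 2 = k by rewrite divfK// gt_eqF.
have a0 : 0 <= a by rewrite divr_ge0// ltW.
have ak : a <= k by rewrite ler_pdivrMr// ler_peMr.
have -> : 3 * m / (2 * nr + 4 * lambda) = 3 * k by rewrite -mulrA.
clearbody k a.
pose g x := a * sqdist z x + - (4 * k).
have Cg : class_C 2 g by exact: class_C_affine_sqdist.
have gE x : g x = a * sqdist z x + - (4 * k) by [].
have Lg x : laplacian g x = 2 * nr * a by exact: laplacian_affine_sqdist.
clearbody g.
have : forall x, 0 <= u x + g x.
  apply: (@min_principle _ _ (fun x => u x + g x) n0 (class_CD Cu Cg)).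
  - move=> x wx; rewrite (laplacianD x Cu Cg) Lg.
    have q0 : 0 <= a * sqdist z x by rewrite mulr_ge0// sqdist_ge0.
    have q4 : sqdist z x < 4 * r ^+ 2.
      rewrite ltNge; apply/negP => h; have := u0 x.
      have := ler_wpM2l a0 h.
      by rewrite mulrCA aE; move: wx; rewrite gE; lra.
    have : lambda * u x <= lambda * (4 * k).
      by rewrite ler_pM2l//; move: wx; rewrite gE; lra.
    have : 2 * nr * a <= 2 * nr * k by apply: ler_wpM2l => //; lra.
    by have := Hm x q4; rewrite -kE; lra.
  - move=> e e0; exists (2 * r + `|z|) => x h.
    have := @sqdist_far z x (2 * r) _ h; have := u0 x.
    have r2 : 0 <= 2 * r by lra.
    move=> ux /(_ r2) h'; have := ler_wpM2l a0 h'.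
    by rewrite exprMn mulrCA aE gE; lra.
move=> H x qx; have := H x; rewrite gE.
by have := ler_wpM2l a0 qx; rewrite aE; lra.
Qed.

(* For h = 1 + |x-z|^2/rho^2 the barrier h^-a + (n-2) h^-(a+1), a = (n-2)/2, is
   subharmonic where h >= n+2, is at most n-1, and decays like |x|^(2-n). *)
Lemma superharmonic_lower_bound v z (m rho : R) : class_C 2 v ->
  (forall x, 0 <= v x) -> (forall x, laplacian v x <= 0) -> 0 <= m -> 0 < rho ->
  (forall x, sqdist z x <= rho ^+ 2 * (nr + 1) -> m <= v x) ->
  forall x, m / (nr - 1) * radial_power (rho ^- 2) ((nr - 2) / 2) z x <= v x.
Proof.
have nr3 := @natr_ge3 R n _ n3 erefl.
move=> Cv v0 Lv m0 rho0 Hm.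
have rho20 : 0 < rho ^+ 2 by exact: exprn_gt0.
pose c := rho ^- 2; have c0 : 0 < c by rewrite invr_gt0.
have cE : c * rho ^+ 2 = 1 by rewrite mulVf// gt_eqF.
pose a : R := (nr - 2) / 2.
have a0 : 0 < a by rewrite divr_gt0//; lra.
have a2 : 2 * a = nr - 2 by rewrite /a; field.
rewrite -/c -/a.
pose k := m / (nr - 1).
have k0 : 0 <= k by rewrite divr_ge0//; lra.
have kE : k * (nr - 1) = m by rewrite divfK// gt_eqF//; lra.
rewrite -/k; clearbody k a c.
pose P s := radial_power c s z.
have CP s : class_C 2 (P s) by exact: class_C_radial_power (ltW c0).
have LP s x : laplacian (P s) x = 2 * c * s *
    ((2 * s + 2 - nr) * P (s + 1) x - 2 * (s + 1) * P (s + 2) x).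
  exact: laplacian_radial_power (ltW c0).
have PE s x : P s x = (1 + c * sqdist z x) `^ (- s) by [].
clearbody P.
have h1 x : 1 <= 1 + c * sqdist z x := radial_power_base_ge1 z x (ltW c0).
have Pgt0 s x : 0 < P s x.
  by rewrite PE powR_gt0// (lt_le_trans ltr01).
have PS s x : P s x = (1 + c * sqdist z x) * P (s + 1) x.
  have hx : 0 < 1 + c * sqdist z x by rewrite (lt_le_trans ltr01).
  rewrite !PE -[X in _ = X * _](powRr1 (ltW hx)) -powRD.
    by congr (_ `^ _); ring.
  by rewrite (gt_eqF hx) implybT.
have Ple1 s x : 0 <= s -> P s x <= 1.
  move=> s0; rewrite PE powRN invf_le1 ?powR_gt0 ?(lt_le_trans ltr01)//.
  by have := ler_powR (h1 x) s0; rewrite powRr0.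
have Pmono x : P (a + 1) x <= P a x.
  by rewrite (PS a) ler_peMl// ltW.
pose g x := (- k) * P a x + (- (k * (nr - 2))) * P (a + 1) x.
have C1 : class_C 2 (fun x => (- k) * P a x).
  by apply: class_CM; [exact: class_C_cst|exact: CP].
have C2 : class_C 2 (fun x => (- (k * (nr - 2))) * P (a + 1) x).
  by apply: class_CM; [exact: class_C_cst|exact: CP].
have Cg : class_C 2 g by exact: class_CD C1 C2.
have gE x : g x = - (k * P a x + k * (nr - 2) * P (a + 1) x).
  by rewrite /g; ring.
(* Since 2a + 2 = n, the Laplacian of h^-a is reduced to a negative multiple of h^(-a-2). The weight
   n - 2 on h^-(a+1) contributes twice the opposite multiple, plus a term in h^(-a-3), so the total
   has the sign of h - (n+2). *)
have Lg x : laplacian g x = - (k * (c * nr * (nr - 2) *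
    (1 + c * sqdist z x - (nr + 2)) * P (a + 3%:R) x)).
  rewrite (laplacianD x C1 C2) (laplacianZ _ x (CP a)) (laplacianZ _ x (CP (a + 1))).
  rewrite !LP.
  have -> : a + 1 + 1 = a + 2 by ring.
  have -> : a + 1 + 2 = a + 3%:R by ring.
  have -> : P (a + 1) x = (1 + c * sqdist z x) * P (a + 2) x.
    by rewrite PS -addrA.
  have -> : P (a + 2) x = (1 + c * sqdist z x) * P (a + 3%:R) x.
    by rewrite PS; congr (_ * P _ x); ring.
  have -> : nr = 2 * a + 2 by rewrite a2; ring.
  move: (P _ _) (sqdist z x) => e q; ring.
clearbody g.
have : forall x, 0 <= v x + g x.
  apply: (@min_principle _ _ (fun x => v x + g x) n0 (class_CD Cv Cg)).
  - move=> x wx; rewrite (laplacianD x Cv Cg) Lg.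
    have [/Hm mv|qx] := leP (sqdist z x) (rho ^+ 2 * (nr + 1)).
      exfalso; move: wx; rewrite gE -kE in mv *.
      have := ler_wpM2l k0 (Ple1 a x (ltW a0)).
      have a10 : 0 <= a + 1 by lra.
      have kn0 : 0 <= k * (nr - 2) by rewrite mulr_ge0//; lra.
      have := ler_wpM2l kn0 (Ple1 (a + 1) x a10).
      lra.
    have qc : nr + 2 <= 1 + c * sqdist z x.
      have := ler_wpM2l (ltW c0) (ltW qx); rewrite mulrA cE mul1r; lra.
    have : 0 <= k * (c * nr * (nr - 2) *
        (1 + c * sqdist z x - (nr + 2)) * P (a + 3%:R) x).
      apply: mulr_ge0 => //; apply: mulr_ge0; last exact: ltW.
      apply: mulr_ge0; last by lra.
      by apply: mulr_ge0; [apply: mulr_ge0; [exact: ltW|lra]|lra].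
    by have := Lv x; lra.
  - move=> e e0.
    (* Far away h >= y^2, and 2a = n - 2 >= 1 gives h^-a <= 1/y. The barrier is at most m h^-a,
       hence at most [e]. *)
    pose y := m / e + 1.
    have y0 : 0 < y by rewrite ltr_pwDr// divr_ge0// ltW.
    have ye : m <= e * y by rewrite /y mulrDr mulrCA divff ?gt_eqF// mulr1; lra.
    exists (rho * y + `|z|) => x h.
    have rhoy0 : 0 <= rho * y by rewrite mulr_ge0// ltW.
    have qy := sqdist_far rhoy0 h.
    have hy : y ^+ 2 <= 1 + c * sqdist z x.
      have := ler_wpM2l (ltW c0) qy.
      by rewrite exprMn mulrA cE mul1r; lra.
    have hx : 0 < 1 + c * sqdist z x by rewrite (lt_le_trans ltr01).
    have Py : P a x <= y^-1.
      rewrite PE powRN lef_pV2 ?posrE ?powR_gt0//.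
      apply: (@le_trans _ _ ((1 + c * sqdist z x) `^ (2^-1))).
        rewrite powR12_sqrt ?(ltW hx)// -[leLHS]ger0_norm ?(ltW y0)//.
        by rewrite -sqrtr_sqr ler_wsqrtr.
      apply: ler_powR; first exact: h1.
      by rewrite -(ler_pM2l (_ : 0 < 2))// a2 divff//; lra.
    have : k * P a x + k * (nr - 2) * P (a + 1) x <= m * P a x.
      have kn0 : 0 <= k * (nr - 2) by rewrite mulr_ge0//; lra.
      have := ler_wpM2l kn0 (Pmono x); rewrite -kE; lra.
    have : m * P a x <= e.
      apply: le_trans (ler_wpM2l m0 Py) _.
      by rewrite ler_pdivrMr.
    by have := v0 x; rewrite gE; lra.
move=> H x; have := H x; rewrite gE /radial_power -PE.
have : 0 <= k * (nr - 2) * P (a + 1) x.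
  by rewrite mulr_ge0 ?(ltW (Pgt0 _ _))// mulr_ge0//; lra.
lra.
Qed.

End comparison.

(** * The logarithmic kernel *)

Section log_kernel_convolution.
Context {R : realType} {n : nat}.
Local Notation rT := (measurableTypeR R).
Local Notation leb := (@lebesgue_measure_tuple R n).
Implicit Types (u v : 'rV[R]_n -> R) (x y z : 'rV[R]_n).

Lemma continuous_enormB x : continuous (fun y => enorm (x - y)).
Proof.
rewrite (_ : (fun _ => _) = fun y => Num.sqrt (sqdist x y)); last first.
  by apply/funext => y; rewrite -enorm_sqr sqrtr_sqr ger0_norm ?enorm_ge0// /enorm;
    congr Num.sqrt; apply: eq_bigr => i _; rewrite !mxE -sqrrN opprB.
move=> y; apply: (@continuous_comp _ _ _ (sqdist x) Num.sqrt).
  exact: continuous_sqdist.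
exact: sqrt_continuous.
Qed.

Lemma measurable_log_kernel (alpha beta : R) x : measurable_fun setT
  (fun t : n.-tuple rT => log_kernel alpha beta (x - row_of_tuple t)).
Proof.
have me := measurable_row_of_tuple (@continuous_enormB x).
apply: measurable_funM.
  by apply: (measurableT_comp (measurable_powR (- alpha))); exact: me.
apply: (measurableT_comp (measurable_powR beta)).
apply: (measurableT_comp (@measurable_ln R)).
by apply: measurable_funD => //; exact: me.
Qed.

Lemma measurable_powR_comp (p : R) u : continuous u ->
  measurable_fun setT (fun t : n.-tuple rT => u (row_of_tuple t) `^ p).
Proof.
move=> cu; apply: (measurableT_comp (measurable_powR p)).
exact: measurable_row_of_tuple.
Qed.

Lemma measurable_convolution_integrand (alpha beta p : R) u x : continuous u ->
  measurable_fun setT (fun t : n.-tuple rT =>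
    (log_kernel alpha beta (x - row_of_tuple t) * u (row_of_tuple t) `^ p)%:E).
Proof.
move=> cu; apply/measurable_EFinP; apply: measurable_funM.
  exact: measurable_log_kernel.
exact: measurable_powR_comp.
Qed.

Lemma log_kernel_ge0 (alpha beta : R) x : 0 <= log_kernel alpha beta x.
Proof. by rewrite mulr_ge0// powR_ge0. Qed.

(** The volume (r / (2 sqrt n))^n of a box in the shell r/2 <= |y| <= r, times the lower bound r^-n
    ln(1 + r/2)^beta of the kernel there. For the exponent alpha = n the powers of [r] cancel. *)
Definition kernel_mass (beta r : R) : R :=
  (2 * Num.sqrt n%:R) ^- n * ln (1 + r / 2) `^ beta.

(* The box x - [a, 2a]^n, a = r/(2 sqrt n), lies in the shell
   r/2 <= |x - t| <= r. *)
Lemma convolution_lower_bound (beta p d r : R) u z x : (0 < n)%N -> continuous u ->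
  0 <= beta -> 0 <= p -> 0 <= d -> 0 < r ->
  (forall y, sqdist z y <= (2 * r) ^+ 2 -> d <= u y) ->
  sqdist z x <= r ^+ 2 ->
  ((d `^ p * kernel_mass beta r)%:E <=
    convolution (log_kernel n%:R beta) (fun y => (u y `^ p)%R) x)%E.
Proof.
move=> n0 cu b0 p0 d0 r0 ud qx.
have sn0 : 0 < Num.sqrt (n%:R : R) by rewrite sqrtr_gt0 ltr0n.
have snE : Num.sqrt (n%:R : R) ^+ 2 = n%:R by rewrite sqr_sqrtr.
pose a := r / (2 * Num.sqrt n%:R).
have a0 : 0 < a by rewrite divr_gt0// mulr_gt0.
have aE : n%:R * a ^+ 2 = r ^+ 2 / 4.
  by rewrite /a expr_div_n exprMn snE; field; rewrite pnatr_eq0 -lt0n.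
pose box : set (n.-tuple rT) :=
  [set t | forall i, `[x 0 i - 2 * a, x 0 i - a]%classic (tnth t i)].
have mbox : measurable box.
  rewrite (_ : box = \bigcap_(i in [set: 'I_n])
    ((fun t : n.-tuple rT => tnth t i) @^-1` `[x 0 i - 2 * a, x 0 i - a]%classic)).
    apply: fin_bigcap_measurable => // i _; rewrite -[X in measurable X]setTI.
    by apply: (@measurable_tnth _ rT n i) => //; exact: measurable_itv.
  by apply/seteqP; split => [t h i _|t h i]; exact: h.
have lbox : leb box = (a ^+ n)%:E.
  rewrite (@lebesgue_measure_tuple_box R n
    (fun i => `[x 0 i - 2 * a, x 0 i - a]%classic)); last first.
    by move=> i; exact: measurable_itv.
  rewrite (eq_bigr (fun=> a%:E)).
    by rewrite big_const_ord; elim: (n) => //= m ->; rewrite exprS.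
  move=> i _; rewrite lebesgue_measure_itv /= lte_fin ifT; last by lra.
  by rewrite -EFinB; congr EFin; ring.
pose f (t : n.-tuple rT) : \bar R :=
  (log_kernel n%:R beta (x - row_of_tuple t) * u (row_of_tuple t) `^ p)%:E.
have f0 t : (0 <= f t)%E by rewrite lee_fin mulr_ge0 ?log_kernel_ge0 ?powR_ge0.
have mf : measurable_fun setT f by exact: measurable_convolution_integrand.
pose c := r `^ (- n%:R) * ln (1 + r / 2) `^ beta * d `^ p.
have c0 : 0 <= c by rewrite !mulr_ge0// powR_ge0.
apply: (@le_trans _ _ (\int[leb]_(t in box) c%:E)%E).
  rewrite integral_cst// [X in (_ * X)%E]lbox -EFinM lee_fin.
  rewrite /c /kernel_mass /a powR_invn ?(ltW r0)//.
  have D0 : (2 * Num.sqrt (n%:R : R)) ^+ n != 0.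
    by rewrite expf_neq0// gt_eqF// mulr_gt0.
  have rn0 : r ^+ n != 0 by rewrite expf_neq0// gt_eqF.
  rewrite expr_div_n; move: (powR _ _) (powR _ _) => e1 e2.
  move: (_ ^+ n) D0 (r ^+ n) rn0 => y y0 s s0.
  by rewrite le_eqVlt; apply/orP; left; apply/eqP; field; rewrite y0.
apply: (@le_trans _ _ (\int[leb]_(t in box) f t)%E); last first.
  by apply: ge0_subset_integral.
apply: ge0_le_integral => //; first exact: measurable_funTS.
move=> t tbox; rewrite lee_fin.
have xt i : a <= (x - row_of_tuple t) 0 i <= 2 * a.
  by have := tbox i; rewrite /= in_itv /= !mxE; lra.
have q1 : r ^+ 2 / 4 <= sqdist (row_of_tuple t) x.
  rewrite -aE -[n in n%:R]card_ord -sumr_const mulr_suml; apply: ler_sum => i _.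
  rewrite mul1r ler_sqr ?nnegrE//; first by have := xt i; rewrite !mxE; lra.
    exact: ltW.
  by have := xt i; rewrite !mxE; lra.
have q2 : sqdist (row_of_tuple t) x <= r ^+ 2.
  have -> : r ^+ 2 = n%:R * (2 * a) ^+ 2 by rewrite exprMn mulrCA aE; field.
  rewrite -[n in n%:R]card_ord -sumr_const mulr_suml; apply: ler_sum => i _.
  rewrite mul1r ler_sqr ?nnegrE//; first by have := xt i; rewrite !mxE; lra.
    by have := xt i; rewrite !mxE; lra.
  by rewrite mulr_ge0// ltW.
rewrite -enorm_sqr in q1 q2.
have e1 : r / 2 <= enorm (x - row_of_tuple t).
  rewrite -ler_sqr ?nnegrE ?enorm_ge0//; last by rewrite divr_ge0// ltW.
  by apply: le_trans q1; rewrite exprMn; lra.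
have e2 : enorm (x - row_of_tuple t) <= r.
  by rewrite -ler_sqr ?nnegrE ?enorm_ge0// ltW.
have r20 : 0 < r / 2 by rewrite divr_gt0.
have e0 : 0 < enorm (x - row_of_tuple t) by exact: lt_le_trans e1.
have ut : d <= u (row_of_tuple t).
  apply: ud; apply: le_trans (sqdist_mid x _ z) _.
  by rewrite [sqdist x _]sqdistC -[sqdist (row_of_tuple t) x]enorm_sqr exprMn; lra.
rewrite /c /log_kernel; apply: ler_pM; rewrite ?mulr_ge0 ?powR_ge0//.
  apply: ler_pM; rewrite ?powR_ge0//.
    rewrite !powRN lef_pV2 ?posrE ?powR_gt0//.
    by apply: ge0_ler_powR; rewrite ?nnegrE ?enorm_ge0// ltW.
  apply: ge0_ler_powR; rewrite ?nnegrE ?ln_ge0//; try lra.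
  by rewrite ler_ln ?posrE; lra.
by apply: ge0_ler_powR; rewrite ?nnegrE// (le_trans d0).
Qed.

Lemma kernel_mass_gt0 (beta r : R) : (0 < n)%N -> 0 < r -> 0 < kernel_mass beta r.
Proof.
move=> n0 r0; apply: mulr_gt0.
  by rewrite invr_gt0 exprn_gt0// mulr_gt0// sqrtr_gt0 ltr0n.
by rewrite powR_gt0// ln_gt0// ltrDl divr_gt0.
Qed.

(** The radius solves ln(1 + r/2) = L with L^beta = B, so the logarithmic factor equals [B]. *)
Lemma kernel_mass_unbounded (beta A : R) : (0 < n)%N -> 0 < beta ->
  exists2 r : R, 1 <= r & A < kernel_mass beta r.
Proof.
move=> n0 b0.
pose c : R := (2 * Num.sqrt n%:R) ^- n.
have c0 : 0 < c by rewrite invr_gt0 exprn_gt0// mulr_gt0// sqrtr_gt0 ltr0n.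
pose B := Num.max 1 (A / c + 1).
have B1 : 1 <= B by rewrite le_max lexx.
have BA : A / c < B by rewrite lt_max ltrDl ltr01 orbT.
pose L := B `^ beta^-1.
have L1 : 1 <= L.
  have := ler_powR B1 (_ : 0 <= beta^-1); rewrite powRr0; apply.
  by rewrite invr_ge0 ltW.
exists (2 * (expR L - 1)).
  have := expR_ge1Dx L; lra.
rewrite /kernel_mass (_ : 1 + 2 * (expR L - 1) / 2 = expR L); last by field.
rewrite expRK -/c /L -powRrM mulVf ?gt_eqF// powRr1; last by lra.
by rewrite mulrC -ltr_pdivrMr.
Qed.

(* On |z - t| >= 1 the kernel is at least c |z - t|^(-n), and u <= 1 + u^p. *)
Lemma convolution_finite_growth (beta p : R) u z : (0 < n)%N -> continuous u ->
  0 <= beta -> 1 <= p -> (forall y, 0 <= u y) ->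
  (convolution (log_kernel n%:R beta) (fun y => (u y `^ p)%R) z < +oo)%E ->
  exists C : R, forall r : R, 1 <= r ->
    \int[leb]_(t in cube z r) u (row_of_tuple t) <= C * r ^+ n.
Proof.
move=> n0 cu b0 p1 u0 cfin.
pose g (t : n.-tuple rT) : R :=
  log_kernel n%:R beta (z - row_of_tuple t) * u (row_of_tuple t) `^ p.
have g0 t : 0 <= g t by rewrite mulr_ge0 ?log_kernel_ge0 ?powR_ge0.
have mg : measurable_fun setT (EFin \o g) by exact: measurable_convolution_integrand.
have ig : leb.-integrable setT (EFin \o g).
  apply/integrableP; split => //.
  by under eq_integral do rewrite /= ger0_norm//.
have [M M0 HM] := continuous_cube_bound z 1 cu.
have sn0 : 0 < Num.sqrt (n%:R : R) by rewrite sqrtr_gt0 ltr0n.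
have sn1 : 1 <= Num.sqrt (n%:R : R).
  by rewrite -[leLHS]sqrtr1 ler_wsqrtr// ler1n.
have ln20 : 0 < ln (2 : R) by rewrite ln_gt0// ltr1n.
(* In the cube of radius [r] one has |z-t| <= sqrt n * r, and |z-t| >= 1 makes the logarithm at
   least ln 2; thus c1 r^n times the kernel is at least 1. *)
pose c1 : R := (Num.sqrt n%:R ^+ n) / ln 2 `^ beta.
have c10 : 0 <= c1 by rewrite divr_ge0 ?powR_ge0 ?exprn_ge0// ltW.
pose I0 : R := \int[leb]_t g t.
have I00 : 0 <= I0 by apply: Rintegral_ge0.
exists ((1 + M) * 2 ^+ n + c1 * I0) => r r1.
have r0 : 0 < r by lra.
have rn0 : 0 <= r ^+ n by rewrite exprn_ge0// ltW.
have mc := measurable_cube z r.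
have igc : leb.-integrable (cube z r) (EFin \o g).
  by apply: integrableS ig.
have ugb t : cube z r t -> u (row_of_tuple t) <= 1 + M + c1 * r ^+ n * g t.
  move=> tr; rewrite /cube /= distrC in tr.
  have cg0 : 0 <= c1 * r ^+ n * g t by rewrite mulr_ge0// mulr_ge0.
  have [et|et] := ltP (enorm (z - row_of_tuple t)) 1.
    have : `|u (row_of_tuple t)| <= M.
      apply: HM; rewrite -ler_sqr ?nnegrE// expr1n.
      apply: le_trans (norm_sqr_le_sqdist _ _) _.
      by rewrite sqdistC -enorm_sqr exprn_ile1 ?enorm_ge0// ltW.
    by have := ler_norm (u (row_of_tuple t)); lra.
  have e0 : 0 < enorm (z - row_of_tuple t) by lra.
  have er : enorm (z - row_of_tuple t) <= Num.sqrt n%:R * r.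
    rewrite -ler_sqr ?nnegrE ?enorm_ge0//; last by rewrite mulr_ge0// ltW.
    rewrite enorm_sqr exprMn sqr_sqrtr//.
    apply: le_trans (sqdist_le_norm _ _) _.
    by rewrite ler_wpM2l// ler_sqr ?nnegrE// ltW.
  have K1 : 1 <= c1 * r ^+ n * log_kernel n%:R beta (z - row_of_tuple t).
    have E : c1 * r ^+ n *
        ((Num.sqrt n%:R * r) `^ (- n%:R) * ln 2 `^ beta) = 1.
      rewrite powR_invn ?mulr_ge0 ?(ltW r0)// /c1 exprMn.
      by field; rewrite !expf_neq0 ?gt_eqF// powR_gt0.
    rewrite -[leLHS]E; apply: ler_wpM2l; first by rewrite mulr_ge0.
    apply: ler_pM; rewrite ?powR_ge0//.
      rewrite !powRN lef_pV2 ?posrE ?powR_gt0 ?mulr_gt0//.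
      by apply: ge0_ler_powR; rewrite ?nnegrE ?mulr_ge0 ?enorm_ge0// ltW.
    apply: ge0_ler_powR; rewrite ?nnegrE ?ln_ge0//; try lra.
    by rewrite ler_ln ?posrE; lra.
  have up : u (row_of_tuple t) <= 1 + u (row_of_tuple t) `^ p.
    have [u1|u1] := leP (u (row_of_tuple t)) 1.
      by have := powR_ge0 (u (row_of_tuple t)) p; lra.
    by have := le1r_powR (ltW u1) p1; lra.
  have : u (row_of_tuple t) `^ p <= c1 * r ^+ n * g t.
    by rewrite /g mulrA -[leLHS]mul1r ler_wpM2r ?powR_ge0.
  lra.
apply: (@le_trans _ _ (\int[leb]_(t in cube z r) (1 + M + c1 * r ^+ n * g t))).
  apply: le_Rintegral => //; first exact: integrable_cube.
  have i1 := integrable_cube z r (@cst_continuous _ _ (1 + M) : continuous (fun _ : 'rV[R]_n => 1 + M)).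
  have := integrableD mc i1 (integrableZl mc (c1 * r ^+ n) igc).
  by apply: eq_integrable.
rewrite RintegralD//; first last.
- have := integrableZl mc (c1 * r ^+ n) igc.
  by apply: eq_integrable.
- exact: (integrable_cube z r (@cst_continuous _ _ (1 + M) : continuous (fun _ : 'rV[R]_n => 1 + M))).
rewrite Rintegral_cst// [X in fine X](lebesgue_measure_cube z (ltW r0)) /=.
rewrite RintegralZl//.
have -> : ((1 + M) * 2 ^+ n + c1 * I0) * r ^+ n =
    (1 + M) * (2 * r) ^+ n + c1 * r ^+ n * I0 by rewrite exprMn; ring.
rewrite lerD2l; apply: ler_wpM2l; first exact: mulr_ge0.
rewrite /I0 Rintegral_mkcond; apply: le_Rintegral => //.
  by have /integrable_mkcond := igc; move=> /(_ mc); rewrite restrict_EFin.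
by move=> t _; rewrite /patch; case: ifP.
Qed.

End log_kernel_convolution.

(** * Nonexistence *)

Section powR_monotonicity.
Context {R : realType}.

Lemma powRN_le (a b s : R) : 0 <= s -> 0 < a -> a <= b -> b `^ (- s) <= a `^ (- s).
Proof.
move=> s0 a0 ab; have b0 := lt_le_trans a0 ab.
rewrite !powRN lef_pV2 ?posrE ?powR_gt0//.
by apply: ge0_ler_powR => //; rewrite nnegrE ltW.
Qed.

Lemma powRN_le1 (a s : R) : 0 <= s -> 1 <= a -> a `^ (- s) <= 1.
Proof. by move=> s0 a1; have := powRN_le s0 ltr01 a1; rewrite powR1. Qed.

Lemma sqr_powR_half (a s : R) : 0 <= a -> (a ^+ 2) `^ (s / 2) = a `^ s.
Proof.
by move=> a0; rewrite -(powR_mulrn _ a0) -powRrM mulrC divfK.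
Qed.

End powR_monotonicity.

Section nonexistence.
Context {R : realType} {n : nat}.
Hypothesis n3 : (3 <= n)%N.
Variables (lambda beta p q : R).
Hypotheses (lambda0 : 0 < lambda) (beta0 : 0 < beta) (p1 : 1 <= p) (q0 : 0 < q).
Variable u : 'rV[R]_n -> R.
Hypothesis solu : nonneg_solution lambda n%:R beta p q u.
Implicit Types (x z : 'rV[R]_n).

Let v x := lambda * u x - laplacian u x.

Let n0 : (0 < n)%N. Proof. exact: leq_trans n3. Qed.

Let Cu : class_C 4 u. Proof. by case: solu. Qed.

Let u0 x : 0 <= u x. Proof. by case: solu. Qed.

Let Cu2 : class_C 2 u. Proof. by do 2 apply: class_CW. Qed.

Let cu : continuous u. Proof. exact: class_C_continuous Cu. Qed.

Let C1 : class_C 2 (fun x => lambda * u x).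
Proof. by apply: class_CM; [exact: class_C_cst|exact: Cu2]. Qed.

Let C2 : class_C 2 (fun x => (-1) * laplacian u x).
Proof. by apply: class_CM; [exact: class_C_cst|exact: class_C_laplacian]. Qed.

Let vE : v = fun x => lambda * u x + (-1) * laplacian u x.
Proof. by apply/funext => x; rewrite mulN1r. Qed.

Let Cv : class_C 2 v.
Proof. by rewrite vE; exact: class_CD C1 C2. Qed.

Let Lv x : laplacian v x = - (bilaplacian u x - lambda * laplacian u x).
Proof.
rewrite vE (laplacianD x C1 C2) (laplacianZ lambda x Cu2).
rewrite (laplacianZ (-1) x (class_C_laplacian Cu)) /bilaplacian.
by rewrite mulN1r opprB.
Qed.

Let Lv_le0 x : laplacian v x <= 0.
Proof.
rewrite Lv oppr_le0 -lee_fin; case: solu => _ _ _ /(_ x); apply: le_trans.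
rewrite mule_ge0 ?lee_fin ?powR_ge0//.
apply: integral_ge0 => t _; rewrite lee_fin.
by rewrite mulr_ge0 ?log_kernel_ge0 ?powR_ge0.
Qed.

Let v_ge0 x : 0 <= v x.
Proof.
apply: (supersolution_ge0 n0 Cu u0 (ltW lambda0) Lv_le0).
have p10 : 0 <= beta by exact: ltW.
apply: (convolution_finite_growth n0 cu p10 p1 u0).
by case: solu.
Qed.

(** On the ball of radius [r] the right-hand side of the inequality is at least d^(p+q) times
    [kernel_mass]. Division by 2n fits the Laplacian of the paraboloid. *)
Let v_lower_bound z (d r : R) : 0 < d -> 0 < r ->
  (forall y, sqdist z y <= (2 * r) ^+ 2 -> d <= u y) ->
  forall x, d `^ (p + q) * @kernel_mass R n beta r / (2 * n%:R) *
    (r ^+ 2 - sqdist z x) <= v x.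
Proof.
have pp1 := p1; move=> d0 r0 ud.
have nr0 : (0 : R) < n%:R by rewrite ltr0n.
have m0 := kernel_mass_gt0 beta n0 r0.
have P0 := powR_gt0 (p + q) d0.
apply: (paraboloid_lower_bound n3 Cv v_ge0).
- by apply: ltW; apply: divr_gt0; apply: mulr_gt0.
- exact: ltW.
move=> x xr; rewrite Lv lerN2 -lee_fin.
have [_ _ _ /(_ x)] := solu; apply: le_trans.
have p0 : 0 <= p by lra.
have b0 := ltW beta0.
have := convolution_lower_bound n0 cu b0 p0 (ltW d0) r0 ud (ltW xr).
set c := convolution _ _ _ => hc.
have -> : 2 * n%:R * (d `^ (p + q) * @kernel_mass R n beta r / (2 * n%:R)) =
    d `^ p * @kernel_mass R n beta r * d `^ q.
  rewrite powRD; last by rewrite (gt_eqF d0) implybT.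
  by field; rewrite gt_eqF.
rewrite EFinM; apply: lee_pmul => //; rewrite ?lee_fin ?mulr_ge0 ?powR_ge0 ?(ltW m0)//.
apply: ge0_ler_powR; rewrite ?nnegrE ?(ltW q0) ?(ltW d0)//; apply: ud.
apply: le_trans (ltW xr) _.
by rewrite exprMn; have := sqr_ge0 r; lra.
Qed.

Lemma nonexistence z : u z != 0 -> n%:R / (n%:R - 2) < p + q.
Proof.
have l0 := lambda0; have bt0 := beta0; have pp1 := p1; have qq0 := q0.
move=> uz.
have nr3 := @natr_ge3 R n _ n3 erefl.
rewrite ltNge; apply/negP => pqle.
have {uz}uz0 : 0 < u z by rewrite lt_neqAle eq_sym uz u0.
have pq1 : 0 < p + q - 1 by lra.
have Cv' := Cv; have v0 := v_ge0; have Lv0 := Lv_le0; have vlow := @v_lower_bound z.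
have km0 := @kernel_mass_gt0 R n beta.
have resolv := @resolvent_lower_bound R n n3 u z lambda.
have [r0 r00 ur0] : exists2 r : R, 0 < r &
    forall y, sqdist z y <= (2 * r) ^+ 2 -> u z / 2 <= u y.
  have : \forall y \near z, u z / 2 < u y by apply: (cvgr_gt (u z) (cu (x := z))); lra.
  move=> /nbhs_normP[e /= e0 He]; exists (e / 4); first by lra.
  move=> y ye; apply/ltW/He; rewrite /= distrC.
  rewrite -ltr_sqr ?nnegrE ?normr_ge0 ?(ltW e0)//.
  apply: le_lt_trans (norm_sqr_le_sqdist y z) _; apply: le_lt_trans ye _.
  by rewrite ltr_sqr ?nnegrE; lra.
have vdef x : v x = lambda * u x - laplacian u x by [].
move: (v) Cv' v0 Lv0 vlow vdef => w Cw w0 Lw wlow wdef.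
pose m0 := (u z / 2) `^ (p + q) * @kernel_mass R n beta r0 / (2 * n%:R) * (3 / 4 * r0 ^+ 2).
have nr0 : (0 : R) < n%:R by lra.
have m00 : 0 < m0.
  rewrite /m0 mulr_gt0//; last by rewrite mulr_gt0 ?exprn_gt0//; lra.
  rewrite divr_gt0//; last by lra.
  by rewrite mulr_gt0 ?km0 ?powR_gt0//; lra.
have wm0 x : sqdist z x <= r0 ^+ 2 / 4 -> m0 <= w x.
  move=> xr; have uz2 : 0 < u z / 2 by lra.
  apply: le_trans (wlow _ _ uz2 r00 ur0 x).
  rewrite /m0; apply: ler_wpM2l; last by lra.
  apply: divr_ge0; last by lra.
  by rewrite mulr_ge0 ?powR_ge0// ltW// km0.
have n10 : 0 < n%:R - 1 :> R by lra.
have n20 : 0 < n%:R - 2 :> R by lra.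
have n80 : 0 < 3 / (8 * n%:R) :> R by apply: divr_gt0; lra.
pose a : R := (n%:R - 2) / 2.
have a0 : 0 < a by rewrite divr_gt0//; lra.
pose sn : R := Num.sqrt (n%:R + 1).
have sn0 : 0 < sn by rewrite sqrtr_gt0; lra.
have snE : sn ^+ 2 = n%:R + 1 by rewrite sqr_sqrtr//; lra.
(* The radius rho = r / (2 sqrt(n+1)) satisfies rho^2 (n+1) = r^2/4, so a bound on the ball of
   radius r/2 is what the barrier lemma needs. *)
have harnack (m r : R) : 0 <= m -> 0 < r ->
    (forall x, sqdist z x <= r ^+ 2 / 4 -> m <= w x) ->
    forall x, m / (n%:R - 1) * (1 + 4 * (n%:R + 1) / r ^+ 2 * sqdist z x) `^ (- a) <= w x.
  move=> m1 r1 Hm x.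
  pose rho := r / (2 * sn).
  have rho0 : 0 < rho by rewrite divr_gt0// mulr_gt0.
  have rhoE : rho ^+ 2 * (n%:R + 1) = r ^+ 2 / 4.
    by rewrite -snE /rho; field; rewrite gt_eqF.
  have := @superharmonic_lower_bound R n n3 w z m rho Cw w0 Lw m1 rho0.
  rewrite rhoE => /(_ Hm x); rewrite /radial_power -/a.
  have -> : rho ^- 2 = 4 * (n%:R + 1) / r ^+ 2.
    by rewrite -snE /rho; field; rewrite !gt_eqF.
  exact.
(* For |x-z| <= r/2 and r >= 1, the base in [harnack] applied at [r0] is at most (1 + (n+1)/r0^2)
   r^2, whence M >= c1 r^(-2a) = c1 r^(2-n). *)
pose c1 := m0 / (n%:R - 1) * (1 + (n%:R + 1) / r0 ^+ 2) `^ (- a).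
have base1 : 0 < 1 + (n%:R + 1) / r0 ^+ 2.
  by rewrite addr_gt0// divr_gt0 ?exprn_gt0//; lra.
have c10 : 0 < c1 by rewrite mulr_gt0 ?powR_gt0// divr_gt0//; lra.
(* On the ball of radius 4r the base in [harnack] is at most 1 + 4(n+1) * 16. *)
pose th := (n%:R - 1)^-1 * (1 + 64 * (n%:R + 1)) `^ (- a).
have th0 : 0 < th by rewrite mulr_gt0 ?invr_gt0 ?powR_gt0//; lra.
pose k := 3 / (2 * n%:R + 4 * lambda).
have k0 : 0 < k by rewrite divr_gt0//; lra.
(* The product of all factors in the final estimate c2 * [kernel_mass] <= 1. None of them depends on
   [r], which is chosen only now, to violate this estimate. *)
pose c2 := (k * th) `^ (p + q) * (3 / (8 * n%:R)) * c1 `^ (p + q - 1).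
have c20 : 0 < c2.
  apply: mulr_gt0; last exact: powR_gt0.
  apply: mulr_gt0; first by apply/powR_gt0/mulr_gt0.
  exact: n80.
have [r r1 Hr] := @kernel_mass_unbounded R n beta (c2^-1) n0 beta0.
have rgt0 : 0 < r by lra.
have r2 : 1 <= r ^+ 2 by rewrite exprn_ege1.
pose S := [set w x | x in [set x | sqdist z x <= r ^+ 2 / 4]].
have S0 : S !=set0.
  by exists (w z); exists z => //=; rewrite sqdist_refl; lra.
have Slb : has_lbound S by exists 0 => _ [x _ <-].
pose M := inf S.
have Mle x : sqdist z x <= r ^+ 2 / 4 -> M <= w x.
  by move=> xr; apply: ge_inf => //; exists x.
have Mge X : (forall x, sqdist z x <= r ^+ 2 / 4 -> X <= w x) -> X <= M.
  by move=> H; apply: lb_le_inf => // _ [x xr <-]; exact: H.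
have Mc1 : c1 * (r ^+ 2) `^ (- a) <= M.
  apply: Mge => x xr; apply: le_trans (harnack m0 r0 (ltW m00) r00 wm0 x).
  rewrite /c1 -mulrA; apply: ler_wpM2l; first exact/ltW/divr_gt0.
  rewrite -powRM ?(ltW base1)//; last exact: le_trans ler01 r2.
  have q00 := sqdist_ge0 z x.
  have D0 : 0 <= 4 * (n%:R + 1) / r0 ^+ 2 * sqdist z x.
    by rewrite mulr_ge0 ?divr_ge0 ?exprn_ge0 ?(ltW r00)//; lra.
  apply: (powRN_le (ltW a0)); first exact: (ltr_wpDr D0 ltr01).
  have : 4 * (n%:R + 1) / r0 ^+ 2 * sqdist z x <=
      4 * (n%:R + 1) / r0 ^+ 2 * (r ^+ 2 / 4).
    by apply: ler_wpM2l => //; rewrite divr_ge0 ?exprn_ge0 ?(ltW r00)//; lra.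
  have -> : 4 * (n%:R + 1) / r0 ^+ 2 * (r ^+ 2 / 4) = (n%:R + 1) / r0 ^+ 2 * r ^+ 2 by field; rewrite gt_eqF.
  lra.
have M0 : 0 < M by apply: lt_le_trans Mc1; exact: mulr_gt0 c10 (powR_gt0 _ (lt_le_trans ltr01 r2)).
have wth x : sqdist z x < 4 * (2 * r) ^+ 2 -> th * M <= lambda * u x - laplacian u x.
  move=> xr; rewrite -wdef; apply: le_trans (harnack M r (ltW M0) rgt0 Mle x).
  have -> : th * M = M / (n%:R - 1) * (1 + 64 * (n%:R + 1)) `^ (- a).
    by rewrite /th; move: (powR _ _) (_^-1) => e1 e2; ring.
  apply: ler_wpM2l; first exact/ltW/divr_gt0.
  have q00 := sqdist_ge0 z x.
  have D0 : 0 <= 4 * (n%:R + 1) / r ^+ 2 * sqdist z x.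
    by rewrite mulr_ge0 ?divr_ge0 ?exprn_ge0 ?(ltW rgt0)//; lra.
  apply: (powRN_le (ltW a0)); first exact: (ltr_wpDr D0 ltr01).
  rewrite lerD2l -[leRHS](_ : 4 * (n%:R + 1) / r ^+ 2 * (4 * (2 * r) ^+ 2) = _).
    by apply: ler_wpM2l (ltW xr); rewrite divr_ge0 ?exprn_ge0 ?(ltW rgt0)//; lra.
  by field; rewrite gt_eqF.
have r21 : 1 <= 2 * r by lra.
have thM : 0 < th * M by apply: mulr_gt0.
have ulow y : sqdist z y <= (2 * r) ^+ 2 -> k * th * M <= u y.
  move=> yr; have := resolv (th * M) (2 * r) Cu2 u0 lambda0 (ltW thM) r21 wth y yr.
  apply: le_trans; rewrite /k le_eqVlt; apply/orP; left; apply/eqP; field.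
  by rewrite gt_eqF//; lra.
have d0 : 0 < k * th * M by apply: mulr_gt0 => //; apply: mulr_gt0.
have key : (k * th * M) `^ (p + q) * @kernel_mass R n beta r / (2 * n%:R) * (3 / 4 * r ^+ 2) <= M.
  apply: Mge => x xr; apply: le_trans (wlow _ _ d0 rgt0 ulow x).
  apply: ler_wpM2l; last by lra.
  apply: divr_ge0; last by lra.
  by rewrite mulr_ge0 ?powR_ge0// ltW// km0.
have kt0 : 0 < k * th by apply: mulr_gt0.
have MpE : M `^ (p + q) = M `^ (p + q - 1) * M.
  rewrite -[X in _ * X](powRr1 (ltW M0)) -powRD; first by rewrite subrK.
  by rewrite (gt_eqF M0) implybT.
have key2 : (k * th) `^ (p + q) * (3 / (8 * n%:R)) * @kernel_mass R n beta r *
    (M `^ (p + q - 1) * r ^+ 2) <= 1.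
  rewrite -(ler_pM2r M0) mul1r; apply: le_trans key.
  rewrite le_eqVlt; apply/orP; left; apply/eqP.
  rewrite (powRM _ (ltW kt0) (ltW M0)) MpE.
  move: (@kernel_mass _ _ _ _) (powR _ _) (powR _ _) => e1 e2 e3.
  by field; rewrite gt_eqF.
(* After inserting M >= c1 (r^2)^(-a), the remaining power of r^2 has exponent 1 - a (p+q-1),
   nonnegative exactly under the assumption p + q <= n/(n-2). *)
have key3 : c1 `^ (p + q - 1) <= M `^ (p + q - 1) * r ^+ 2.
  have : (c1 * (r ^+ 2) `^ (- a)) `^ (p + q - 1) <= M `^ (p + q - 1).
    by apply: ge0_ler_powR; rewrite ?nnegrE ?(ltW pq1) ?(ltW M0)// mulr_ge0 ?powR_ge0 ?(ltW c10).
  have r2gt0 : 0 < r ^+ 2 by exact: lt_le_trans ltr01 r2.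
  move=> /(ler_wpM2r (ltW r2gt0)); apply: le_trans.
  rewrite powRM ?powR_ge0 ?(ltW c10)// -mulrA ler_peMr ?powR_ge0//.
  rewrite -powRrM -[X in _ * X](powRr1 (ltW r2gt0)) -powRD; last first.
    by rewrite (gt_eqF r2gt0) implybT.
  have := ler_powR r2 (_ : 0 <= - a * (p + q - 1) + 1); rewrite powRr0; apply.
  have := ler_wpM2l (ltW a0) pqle.
  have -> : a * (n%:R / (n%:R - 2)) = n%:R / 2.
    by rewrite /a; field; rewrite (gt_eqF n20).
  rewrite /a; lra.
have : c2 * @kernel_mass R n beta r <= 1.
  apply: le_trans key2; rewrite /c2 mulrAC.
  apply: ler_wpM2l key3.
  apply: mulr_ge0; last exact/ltW/km0.
  exact: mulr_ge0 (powR_ge0 _ _) (ltW n80).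
move: Hr; rewrite -(ltr_pM2l c20) divff ?gt_eqF// => h1 h2.
by move: (lt_le_trans h1 h2); rewrite ltxx.
Qed.

End nonexistence.

(** * Riesz potentials *)

Section dyadic_majorants.
Context {R : realType} {n : nat}.
Local Notation rT := (measurableTypeR R).
Local Notation leb := (@lebesgue_measure_tuple R n).
Implicit Types (x y z c : 'rV[R]_n) (a r : nat -> R).

(** Cubes have explicit measure, so such a step function is integrated term by term; this takes the
    place of polar coordinates. *)
Definition cube_series c a r (t : n.-tuple rT) : \bar R :=
  (\sum_(0 <= k <oo) (a k * \1_(cube c (r k)) t)%:E)%E.

Lemma measurable_cube_term c a r k :
  measurable_fun setT (fun t : n.-tuple rT => (a k * \1_(cube c (r k)) t)%:E).
Proof.
apply/measurable_EFinP; apply: measurable_funM => //.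
by apply: measurable_indic; exact: measurable_cube.
Qed.

Lemma cube_term_ge0 c a r k (t : n.-tuple rT) : (forall k, 0 <= a k) ->
  (0 <= (a k * \1_(cube c (r k)) t)%:E)%E.
Proof. by move=> a0; rewrite lee_fin mulr_ge0. Qed.

Lemma measurable_cube_series c a r : (forall k, 0 <= a k) ->
  measurable_fun setT (cube_series c a r).
Proof.
move=> a0; apply: ge0_emeasurable_sum.
- by move=> k t _ _; exact: cube_term_ge0.
- by move=> k _; exact: measurable_cube_term.
Qed.

Lemma cube_series_ge0 c a r t : (forall k, 0 <= a k) -> (0 <= cube_series c a r t)%E.
Proof. by move=> a0; apply: nneseries_ge0 => k _ _; exact: cube_term_ge0. Qed.

Lemma cube_series_ge c a r t k : (forall k, 0 <= a k) -> cube c (r k) t ->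
  ((a k)%:E <= cube_series c a r t)%E.
Proof.
move=> a0 tk.
apply: le_trans (nneseries_lim_ge (m := 0) k.+1 (fun j _ _ => cube_term_ge0 c r j t a0)).
rewrite big_nat_recr//= indicE mem_set// mulr1 leeDr//.
by apply: sume_ge0 => j _; exact: cube_term_ge0.
Qed.

Lemma integral_cube_series c a r (b q : R) : (forall k, 0 <= a k) ->
  (forall k, 0 <= r k) -> 0 <= b -> 0 < q < 1 ->
  (forall k, a k * (2 * r k) ^+ n = b * q ^+ k) ->
  (\int[leb]_t cube_series c a r t <= (b / (1 - q))%:E)%E.
Proof.
move=> a0 r0 b0 /andP[q0 q1] abq.
rewrite integral_nneseries//; last 2 first.
- by move=> k; exact: measurable_cube_term.
- by move=> k t _; exact: cube_term_ge0.
have E k : (\int[leb]_t (a k * \1_(cube c (r k)) t)%:E = (b * q ^+ k)%:E)%E.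
  under eq_integral do rewrite EFinM.
  rewrite ge0_integralZl_EFin//; last first.
    by apply/measurable_EFinP; apply: measurable_indic; exact: measurable_cube.
  rewrite integral_indic; [|exact: measurableT|exact: measurable_cube].
  rewrite setIT.
  by rewrite [X in (_ * X)%E](lebesgue_measure_cube c (r0 k)) -EFinM abq.
under eq_eseriesr do rewrite E.
apply: lime_le.
  by apply: is_cvg_nneseries => k _ _; rewrite lee_fin mulr_ge0// exprn_ge0// ltW.
apply: nearW => N; rewrite sumEFin lee_fin.
by apply: geometric_le_lim => //; rewrite ger0_norm// ltW.
Qed.

(* The two series below majorize min(rho^-A, rho^-B), rho the sup norm of
   t - c, by constants on dyadic cubes. *)
Definition inner_series (A : R) c :=
  cube_series c (fun k => (2 `^ A) ^+ k.+1) (fun k => 2^-1 ^+ k).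

Definition outer_series (B : R) c :=
  cube_series c (fun k => (2 `^ (- B)) ^+ k) (fun k => 2 ^+ k.+1).

Definition dyadic_majorant (A B : R) c t : \bar R :=
  (inner_series A c t + outer_series B c t)%E.

Let inner_ge0 (A : R) k : 0 <= (2 `^ A) ^+ k.+1 :> R.
Proof. by rewrite exprn_ge0// powR_ge0. Qed.

Let outer_ge0 (B : R) k : 0 <= (2 `^ (- B)) ^+ k :> R.
Proof. by rewrite exprn_ge0// powR_ge0. Qed.

Lemma dyadic_majorant_ge0 A B c t : (0 <= dyadic_majorant A B c t)%E.
Proof. by rewrite adde_ge0// cube_series_ge0. Qed.

Lemma measurable_dyadic_majorant A B c :
  measurable_fun setT (dyadic_majorant A B c).
Proof. by apply: emeasurable_funD; exact: measurable_cube_series. Qed.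

Lemma powR2_lt1 (b : R) : b < 0 -> 2 `^ b < 1.
Proof.
by move=> b0; rewrite /powR gt_eqF// expR_lt1 nmulr_rlt0// ln_gt0// ltr1n.
Qed.

Lemma powRX_comm (b : R) k : 0 <= b -> forall s, (b `^ s) ^+ k = (b ^+ k) `^ s.
Proof.
by move=> b0 s; rewrite -(powR_mulrn _ (powR_ge0 _ _)) -(powR_mulrn _ b0) powRAC.
Qed.

Lemma lt_exp2 (rho : R) : exists k, rho < 2 ^+ k.+1.
Proof.
exists (Num.bound `|rho|); apply: (@lt_le_trans _ _ (Num.bound `|rho|)%:R).
  by apply: le_lt_trans (ler_norm rho) _; apply: archi_boundP.
by rewrite -natrX ler_nat expnS (leq_trans (ltnW (ltn_expl _ (ltnSn 1))))// leq_pmull.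
Qed.

(** The term integrals are geometric with ratios 2^(A-n) and 2^(n-B), both below 1. The measure of a
    cube ignores its centre, so the bound is uniform in [c]. *)
Lemma integral_dyadic_majorant (A B : R) : A < n%:R -> n%:R < B ->
  exists2 C : R, 0 <= C & forall c, (\int[leb]_t dyadic_majorant A B c t <= C%:E)%E.
Proof.
move=> An nB.
have two0 : (2 : R) != 0 by [].
pose q1 : R := 2 `^ (A - n%:R); pose q2 : R := 2 `^ (n%:R - B).
have q1b : 0 < q1 < 1.
  by rewrite powR_gt0//= powR2_lt1// subr_lt0.
have q2b : 0 < q2 < 1.
  by rewrite powR_gt0//= powR2_lt1// subr_lt0.
exists (2 `^ A * 2 ^+ n / (1 - q1) + 4 ^+ n / (1 - q2)).
  move: q1b q2b => /andP[_ h1] /andP[_ h2].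
  by rewrite addr_ge0// divr_ge0 ?mulr_ge0 ?powR_ge0// ?exprn_ge0//; lra.
move=> c; rewrite ge0_integralD//; last 4 first.
- by move=> t _; exact: cube_series_ge0.
- exact: measurable_cube_series.
- by move=> t _; exact: cube_series_ge0.
- exact: measurable_cube_series.
rewrite EFinD; apply: leeD.
  apply: integral_cube_series => //.
    move=> k; rewrite /q1 powRB ?two0 ?implybT// powR_mulrn//.
    rewrite exprS exprMn expr_div_n -!exprM [(k * n)%N]mulnC exprVn.
    by rewrite mulrACA mulrA.
apply: integral_cube_series => //.
  move=> k; rewrite /q2 [n%:R - B]addrC powRD ?two0 ?implybT// powR_mulrn//.
  rewrite !exprMn exprS !exprMn -!exprM [(k * n)%N]mulnC.
  have -> : (4 : R) ^+ n = 2 ^+ n * 2 ^+ n by rewrite -exprMn; congr (_ ^+ _); ring.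
  ring.
Qed.

(** The first inner cube alone suffices, and it includes the centre, which [dyadic_majorant_ge]
    excludes. *)
Lemma dyadic_majorant_ge1 (A B : R) c t : 0 <= A -> `|row_of_tuple t - c| <= 1 ->
  (1 <= dyadic_majorant A B c t)%E.
Proof.
move=> A0 t1; apply: (@le_trans _ _ (inner_series A c t)); last first.
  by rewrite leeDl// cube_series_ge0.
apply: le_trans (cube_series_ge (k := 0) (inner_ge0 A) _); last first.
  by rewrite /cube /= expr0.
rewrite lee_fin expr1 -[leLHS](powRr0 2); apply: ler_powR => //.
by rewrite ler1n.
Qed.

(** A minimal [k] places rho between consecutive powers of 2, and the single term of that index
    already dominates. *)
Lemma dyadic_majorant_ge (A B g : R) c t : 0 <= A -> 0 <= B ->
  0 < `|row_of_tuple t - c| ->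
  g <= `|row_of_tuple t - c| `^ (- A) -> g <= `|row_of_tuple t - c| `^ (- B) ->
  (g%:E <= dyadic_majorant A B c t)%E.
Proof.
set rho := `|_ - _| => A0 B0 rho0 gA gB.
have two1 : (1 : R) < 2 by rewrite ltr1n.
have [rho1|rho1] := leP rho 1.
  have exk : exists k, (2^-1 : R) ^+ k.+1 < rho.
    have [k hk] := lt_exp2 rho^-1.
    by exists k; rewrite exprVn invf_plt ?posrE// exprn_gt0.
  case: (ex_minnP exk) => k kr kmin.
  have rk : rho <= 2^-1 ^+ k.
    case: k kr kmin => [|k] kr kmin; first by rewrite expr0.
    by rewrite leNgt; apply/negP => /kmin; rewrite ltnn.
  apply: (@le_trans _ _ (inner_series A c t)); last first.
    by rewrite leeDl// cube_series_ge0.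
  apply: le_trans (cube_series_ge (k := k) (inner_ge0 A) rk).
  rewrite lee_fin (le_trans gA)// powRX_comm// powRN -[leLHS]mul1r.
  rewrite ler_pdivrMr ?powR_gt0// -powRM ?exprn_ge0 ?(ltW rho0)//.
  have h1 : 1 <= 2 ^+ k.+1 * rho.
    rewrite -ler_pdivrMl ?exprn_gt0// mulr1 -exprVn; exact: ltW.
  by have := ler_powR h1 A0; rewrite powRr0.
have exk := lt_exp2 rho.
case: (ex_minnP exk) => k kr kmin.
have rk : 2 ^+ k <= rho.
  case: k kr kmin => [|k] kr kmin; first by rewrite expr0 ltW.
  by rewrite leNgt; apply/negP => /kmin; rewrite ltnn.
apply: (@le_trans _ _ (outer_series B c t)); last first.
  by rewrite leeDr// cube_series_ge0.
apply: le_trans (cube_series_ge (k := k) (outer_ge0 B) (ltW kr)).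
rewrite lee_fin (le_trans gB)// powRX_comm// !powRN.
rewrite lef_pV2 ?posrE ?powR_gt0 ?exprn_gt0//.
by apply: ge0_ler_powR; rewrite ?nnegrE ?exprn_ge0// ltW.
Qed.

End dyadic_majorants.

Section convolution_upper_bound.
Context {R : realType} {n : nat}.
Local Notation rT := (measurableTypeR R).
Local Notation leb := (@lebesgue_measure_tuple R n).
Implicit Types (x y z : 'rV[R]_n).

Lemma norm_le_enorm x y : `|x - y| <= enorm (x - y).
Proof.
by rewrite -ler_sqr ?nnegrE ?enorm_ge0// enorm_sqr norm_sqr_le_sqdist.
Qed.

(** With t = d/beta <= 1, ln(1+e) <= (2/t) e^t: for e <= 1 from ln(1+e) <= e <= e^t, for e > 1 from
    t ln(1+e) = ln((1+e)^t) <= (2e)^t. Raising to the power beta turns e^t into e^d. *)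
Lemma log_kernel_upper_bound (beta d : R) x : 0 < d <= beta -> d < n%:R ->
  log_kernel n%:R beta x <= (2 * beta / d) `^ beta * enorm x `^ (d - n%:R).
Proof.
move=> /andP[d0 db] dn; have b0 : 0 < beta by exact: lt_le_trans db.
have := enorm_ge0 x; rewrite /log_kernel; set e := enorm x => e0.
(* At the origin both sides are 0, since [powR] sends 0 to 0 for any nonzero exponent, even a
   negative one. *)
have [->|ene] := eqVneq e 0.
  rewrite !powR0 ?mul0r ?mulr0// ?oppr_eq0; first by rewrite subr_eq0 lt_eqF.
  by rewrite gt_eqF// (lt_trans d0 dn).
have {ene}ep : 0 < e by rewrite lt_neqAle eq_sym ene.
have t0 : 0 < d / beta by rewrite divr_gt0.
have t1 : d / beta <= 1 by rewrite ler_pdivrMr// mul1r.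
have L0 : 0 <= ln (1 + e) by rewrite ln_ge0; lra.
have L : ln (1 + e) <= 2 / (d / beta) * e `^ (d / beta).
  have ed0 := powR_ge0 e (d / beta).
  have [e1|e1] := leP e 1.
    apply: (@le_trans _ _ (1 * e `^ (d / beta))).
      rewrite mul1r; apply: (@le_trans _ _ e).
        by have := @le_ln1Dx R e; apply; lra.
      rewrite -[leLHS]powRr1//; apply: ger_powR => //.
      by rewrite ep.
    rewrite ler_wpM2r// ler_pdivlMr//; lra.
  have p1 : 0 < 1 + e by lra.
  rewrite mulrAC ler_pdivlMr// mulrC -ln_powR.
  have q0 : 0 < (1 + e) `^ (d / beta) by exact: powR_gt0.
  apply: (@le_trans _ _ ((1 + e) `^ (d / beta))).
    rewrite -[X in ln X](_ : 1 + ((1 + e) `^ (d / beta) - 1) = _); last by ring.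
    by apply: le_trans (le_ln1Dx _) _; lra.
  apply: (@le_trans _ _ ((2 * e) `^ (d / beta))).
    by apply: ge0_ler_powR; rewrite ?nnegrE; lra.
  rewrite powRM// ler_wpM2r// -[leRHS]powRr1//; apply: ler_powR => //; lra.
rewrite mulrC.
apply: (@le_trans _ _ ((2 / (d / beta) * e `^ (d / beta)) `^ beta * e `^ (- n%:R))).
  rewrite ler_wpM2r ?powR_ge0//; apply: ge0_ler_powR; rewrite ?nnegrE ?(ltW b0)//.
  exact: le_trans L.
have c0 : 0 <= 2 / (d / beta) by rewrite divr_ge0// ltW.
rewrite (powRM _ c0 (powR_ge0 _ _)) -powRrM divfK ?gt_eqF// powRD; last by rewrite (gt_eqF ep) implybT.
rewrite -mulrA (_ : 2 / (d / beta) = 2 * beta / d)// invf_div; ring.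
Qed.

(** Let e = |x-t| and h = 1 + |t|^2. If e <= 1, the product is at most e^-A; if 1 < e and e^2 <= h,
    at most e^-(A+B); if e^2 > h, at most h^(-(A+B)/2), which the majorant centred at 0 controls.
    Passing to the sup norm only enlarges negative powers. *)
Lemma riesz_integrand_bound (A B : R) x (t : n.-tuple rT) : 0 < A -> 0 <= B ->
  ((enorm (x - row_of_tuple t) `^ (- A) *
     radial_power 1 (B / 2) 0 (row_of_tuple t))%:E <=
   dyadic_majorant A (A + B) x t + dyadic_majorant A (A + B) 0 t)%E.
Proof.
move=> A0 B0.
have AB0 : 0 <= A + B by lra.
rewrite /radial_power mul1r.
have e0 := enorm_ge0 (x - row_of_tuple t).
have rhoe := norm_le_enorm x (row_of_tuple t).
have q0 := sqdist_ge0 0 (row_of_tuple t).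
have rhoq := norm_sqr_le_sqdist (row_of_tuple t) 0.
rewrite subr0 in rhoq.
set e := enorm _ in e0 rhoe *; set q := sqdist _ _ in q0 rhoq *.
have h1 : 1 <= 1 + q by lra.
have B20 : 0 <= B / 2 by lra.
have hB1 := powRN_le1 B20 h1.
have hB0 := powR_ge0 (1 + q) (- (B / 2)).
have rho_gt0 : 0 < e -> 0 < `|row_of_tuple t - x|.
  move=> ep; rewrite normr_gt0 subr_eq0; apply: contraTneq ep => tx.
  by rewrite /e -tx subrr -leNgt /enorm big1 ?sqrtr0// => i _; rewrite !mxE expr0n.
rewrite distrC in rhoe.
have m1 := dyadic_majorant_ge0 A (A + B) x t.
have m2 := dyadic_majorant_ge0 A (A + B) 0 t.
have [E|ene] := eqVneq e 0.
  by rewrite E powR0 ?oppr_eq0 ?gt_eqF// mul0r adde_ge0.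
have {ene}ep : 0 < e by rewrite lt_neqAle eq_sym ene.
have rp := rho_gt0 ep.
have eA0 := powR_ge0 e (- A).
have gA : e `^ (- A) * (1 + q) `^ (- (B / 2)) <= `|row_of_tuple t - x| `^ (- A).
  apply: le_trans (powRN_le (ltW A0) rp rhoe).
  by rewrite ler_piMr.
have [e1|e1] := leP e 1.
  apply: le_trans (leeDl _ m2).
  apply: dyadic_majorant_ge => //; first exact: ltW.
  apply: le_trans gA _; 
  apply: ger_powR; last by lra.
  by rewrite rp (le_trans rhoe).
have [eh|eh] := leP (e ^+ 2) (1 + q).
  apply: le_trans (leeDl _ m2).
  apply: dyadic_majorant_ge => //; first exact: ltW.
  apply: le_trans (powRN_le AB0 rp rhoe).
  rewrite opprD powRD; last by rewrite (gt_eqF ep) implybT.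
  rewrite ler_wpM2l// -[X in _ <= X](_ : (e ^+ 2) `^ (- (B / 2)) = _).
    by apply: powRN_le => //; rewrite exprn_gt0.
  by rewrite -mulNr sqr_powR_half.
apply: le_trans (leeDr _ m1).
have g2 : e `^ (- A) * (1 + q) `^ (- (B / 2)) <= (1 + q) `^ (- ((A + B) / 2)).
  rewrite mulrDl opprD powRD; last by rewrite (gt_eqF (lt_le_trans ltr01 h1)) implybT.
  rewrite ler_wpM2r// -mulNr -(sqr_powR_half _ e0) mulNr.
  by apply: powRN_le; lra.
have AB20 : 0 <= (A + B) / 2 by lra.
have [t1|t1] := leP `|row_of_tuple t| 1.
  apply: le_trans (dyadic_majorant_ge1 _ (ltW A0) _); last by rewrite subr0.
  by rewrite lee_fin (le_trans g2)// powRN_le1.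
have tp : 0 < `|row_of_tuple t| by lra.
have g3 : (1 + q) `^ (- ((A + B) / 2)) <= `|row_of_tuple t| `^ (- (A + B)).
  rewrite -[leRHS](_ : (`|row_of_tuple t| ^+ 2) `^ (- ((A + B) / 2)) = _).
    by apply: powRN_le => //; [rewrite exprn_gt0|lra].
  by rewrite -mulNr sqr_powR_half.
apply: (dyadic_majorant_ge (ltW A0) AB0); rewrite subr0; first exact: tp.
  apply: le_trans g2 _; apply: le_trans g3 _.
  by apply: ler_powR; lra.
exact: le_trans g2 g3.
Qed.

Lemma measurable_enorm_powR (s : R) x : measurable_fun setT
  (fun t : n.-tuple rT => enorm (x - row_of_tuple t) `^ s).
Proof.
apply: (measurableT_comp (measurable_powR s)).
exact: measurable_row_of_tuple (@continuous_enormB R n x).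
Qed.

Lemma measurable_radial_power (s : R) : measurable_fun setT
  (fun t : n.-tuple rT => radial_power 1 s 0 (row_of_tuple t)).
Proof.
exact: measurable_row_of_tuple (@continuous_radial_power R n 1 s 0 ler01).
Qed.

Lemma riesz_potential_bounded (A B : R) : 0 < A -> A < n%:R -> 0 <= B ->
  n%:R < A + B -> exists2 C : R, 0 <= C &
  forall x, (\int[leb]_t (enorm (x - row_of_tuple t) `^ (- A) *
     radial_power 1 (B / 2) 0 (row_of_tuple t))%:E <= C%:E)%E.
Proof.
move=> A0 An B0 AB.
have [C C0 HC] := @integral_dyadic_majorant R n A (A + B) An AB.
exists (C + C); first by rewrite addr_ge0.
move=> x.
apply: (@le_trans _ _ (\int[leb]_t (dyadic_majorant A (A + B) x t +
   dyadic_majorant A (A + B) 0 t))%E).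
  apply: ge0_le_integral => //.
  - by move=> t _; rewrite lee_fin mulr_ge0 ?powR_ge0.
  - apply/measurable_EFinP; apply: measurable_funM.
      exact: measurable_enorm_powR.
    exact: measurable_radial_power.
  - by apply: emeasurable_funD; exact: measurable_dyadic_majorant.
  - by move=> t _; exact: riesz_integrand_bound.
rewrite ge0_integralD//; first by rewrite EFinD leeD.
- by move=> t _; exact: dyadic_majorant_ge0.
- exact: measurable_dyadic_majorant.
- by move=> t _; exact: dyadic_majorant_ge0.
- exact: measurable_dyadic_majorant.
Qed.

(** A pointwise inequality for e = |x-t|, a = |t|^2, b = |x|^2: the power k/2 of the maximum in the
    hypothesis is at most (1+a)^(k/2) + e^k, and each summand is absorbed by one of the two
    factors. *)
Lemma power_decay_split (K c e a b d k mu : R) : 0 <= e -> 0 <= a -> 0 <= b ->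
  0 <= c -> 0 <= k -> d < n%:R -> K <= c * e `^ (d - n%:R) ->
  1 + b <= 4 * Num.max (1 + a) (e ^+ 2) ->
  K * (1 + a) `^ (- (mu / 2)) <= c * 4 `^ (k / 2) * (1 + b) `^ (- (k / 2)) *
   (e `^ (- (n%:R - d)) * (1 + a) `^ (- ((mu - k) / 2)) +
    e `^ (- (n%:R - d - k)) * (1 + a) `^ (- (mu / 2))).
Proof.
move=> e0 a0 b0 c0 k0 dn Kb hq.
have k20 : 0 <= k / 2 by lra.
have h4 : 0 <= 4 `^ (k / 2) :> R by exact: powR_ge0.
apply: le_trans (ler_wpM2r (powR_ge0 _ _) Kb) _.
have [->|ene] := eqVneq e 0.
  rewrite (powR0 (x := d - n%:R)); last by rewrite subr_eq0 lt_eqF.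
  by rewrite mulr0 mul0r !mulr_ge0 ?powR_ge0// addr_ge0// mulr_ge0 ?powR_ge0.
have {ene}ep : 0 < e by rewrite lt_neqAle eq_sym ene.
have ap : 0 < 1 + a by lra.
have bp : 0 < 1 + b by lra.
have -> : e `^ (- (n%:R - d - k)) = e `^ (d - n%:R) * e `^ k.
  by rewrite -powRD ?(gt_eqF ep) ?implybT//; congr powR; ring.
have -> : (1 + a) `^ (- ((mu - k) / 2)) = (1 + a) `^ (- (mu / 2)) * (1 + a) `^ (k / 2).
  by rewrite -powRD ?(gt_eqF ap) ?implybT//; congr powR; ring.
have hb : (1 + b) `^ (k / 2) <= 4 `^ (k / 2) * ((1 + a) `^ (k / 2) + e `^ k).
  apply: (@le_trans _ _ ((4 * Num.max (1 + a) (e ^+ 2)) `^ (k / 2))).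
    by apply: ge0_ler_powR; rewrite ?nnegrE ?(ltW bp)// (le_trans (ltW bp)).
  rewrite powRM//; last by rewrite le_max (ltW ap).
  rewrite ler_wpM2l//; have [_|_] := leP (1 + a) (e ^+ 2).
    by rewrite sqr_powR_half// lerDr powR_ge0.
  by rewrite lerDl powR_ge0.
have b1 : 1 <= (1 + b) `^ (- (k / 2)) * (4 `^ (k / 2) * ((1 + a) `^ (k / 2) + e `^ k)).
  apply: le_trans (ler_wpM2l (powR_ge0 _ _) hb).
  by rewrite -powRD ?(gt_eqF bp) ?implybT// addNr powRr0.
rewrite (_ : - (n%:R - d) = d - n%:R); last by ring.
have ce : 0 <= c * e `^ (d - n%:R) * (1 + a) `^ (- (mu / 2)).
  by rewrite !mulr_ge0 ?powR_ge0.
rewrite -[leLHS]mulr1; apply: le_trans (ler_wpM2l ce b1) _.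
by rewrite le_eqVlt; apply/orP; left; apply/eqP; ring.
Qed.

(* h(x)^(k/2) <= 4^(k/2) (h(t)^(k/2) + |x-t|^k), h = 1 + |.|^2, moves the decay
   in x under the integral sign. *)
Lemma convolution_decay (beta d mu : R) : 0 < d <= beta -> d < n%:R ->
  2 * d <= mu -> mu <= n%:R ->
  exists2 C : R, 0 <= C & forall x,
    (\int[leb]_t (log_kernel n%:R beta (x - row_of_tuple t) *
       radial_power 1 (mu / 2) 0 (row_of_tuple t))%:E <=
     (C * radial_power 1 ((mu - 2 * d) / 2) 0 x)%:E)%E.
Proof.
move=> dbeta dn dmu mun; have d0 : 0 < d by case/andP: dbeta.
(* Giving up 2d instead of d leaves room at infinity: both Riesz potentials below have A + B = n + d
   > n. The assumption mu <= n keeps n - d - k positive. *)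
pose k := mu - 2 * d.
have k0 : 0 <= k by rewrite subr_ge0.
have [||||C1 C10 HC1] := @riesz_potential_bounded (n%:R - d) (mu - k); try (rewrite /k; lra).
have [||||C2 C20 HC2] := @riesz_potential_bounded (n%:R - d - k) mu; try (rewrite /k; lra).
pose c0 : R := (2 * beta / d) `^ beta * 4 `^ (k / 2).
have c00 : 0 <= c0 by rewrite mulr_ge0 ?powR_ge0.
exists (c0 * (C1 + C2)); first by rewrite mulr_ge0// addr_ge0.
move=> x; rewrite -/k.
pose f1 (t : n.-tuple rT) := enorm (x - row_of_tuple t) `^ (- (n%:R - d)) *
   radial_power 1 ((mu - k) / 2) 0 (row_of_tuple t).
pose f2 (t : n.-tuple rT) := enorm (x - row_of_tuple t) `^ (- (n%:R - d - k)) *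
   radial_power 1 (mu / 2) 0 (row_of_tuple t).
have f10 t : 0 <= f1 t by rewrite mulr_ge0 ?powR_ge0.
have f20 t : 0 <= f2 t by rewrite mulr_ge0 ?powR_ge0.
have mf1 : measurable_fun setT f1.
  by apply: measurable_funM; [exact: measurable_enorm_powR|exact: measurable_radial_power].
have mf2 : measurable_fun setT f2.
  by apply: measurable_funM; [exact: measurable_enorm_powR|exact: measurable_radial_power].
pose P := radial_power 1 (k / 2) 0 x.
have P0 : 0 <= P by exact: powR_ge0.
apply: (@le_trans _ _ (\int[leb]_t ((c0 * P)%:E * ((f1 t)%:E + (f2 t)%:E)))%E).
  apply: ge0_le_integral => //.
  - by move=> t _; rewrite lee_fin mulr_ge0 ?log_kernel_ge0 ?powR_ge0.
  - apply/measurable_EFinP; apply: measurable_funM.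
      exact: measurable_log_kernel.
    exact: measurable_radial_power.
  - apply: emeasurable_funM => //.
    by apply: emeasurable_funD; apply/measurable_EFinP.
  move=> t _; rewrite -EFinD -EFinM lee_fin.
  rewrite /f1 /f2 /P /radial_power !mul1r.
  have e0 := enorm_ge0 (x - row_of_tuple t).
  have Kb := log_kernel_upper_bound (x - row_of_tuple t) dbeta dn.
  have hq : 1 + sqdist 0 x <= 4 * Num.max (1 + sqdist 0 (row_of_tuple t))
      (enorm (x - row_of_tuple t) ^+ 2).
    have := sqdist_mid (row_of_tuple t) x 0; rewrite -[sqdist (row_of_tuple t) x]enorm_sqr.
    have : 1 + sqdist 0 (row_of_tuple t) <= Num.max (1 + sqdist 0 (row_of_tuple t))
      (enorm (x - row_of_tuple t) ^+ 2) by rewrite le_max lexx.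
    have : enorm (x - row_of_tuple t) ^+ 2 <= Num.max (1 + sqdist 0 (row_of_tuple t))
      (enorm (x - row_of_tuple t) ^+ 2) by rewrite le_max lexx orbT.
    have := sqdist_ge0 0 (row_of_tuple t).
    lra.
  set e := enorm _ in e0 Kb hq *; set K := log_kernel _ _ _ in Kb *.
  have := sqdist_ge0 0 (row_of_tuple t); have := sqdist_ge0 0 x.
  move: hq; set a := sqdist 0 (row_of_tuple t); set b := sqdist 0 x => hq b0 a0.
  rewrite /c0; apply: power_decay_split; rewrite ?powR_ge0//.
rewrite ge0_integralZl_EFin//; last 3 first.
- by move=> t _; rewrite adde_ge0 ?lee_fin.
- by apply: emeasurable_funD; apply/measurable_EFinP.
- by rewrite mulr_ge0.
rewrite ge0_integralD//; last 4 first.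
- by move=> t _; rewrite lee_fin.
- exact/measurable_EFinP.
- by move=> t _; rewrite lee_fin.
- exact/measurable_EFinP.
have -> : c0 * (C1 + C2) * P = (c0 * P) * (C1 + C2) by ring.
rewrite [leRHS]EFinM; apply: lee_wpmul2l; first by rewrite lee_fin mulr_ge0.
by rewrite EFinD; apply: leeD; [exact: HC1|exact: HC2].
Qed.

End convolution_upper_bound.

(** * Existence *)

Section existence.
Context {R : realType} {n : nat}.
Local Notation rT := (measurableTypeR R).
Local Notation leb := (@lebesgue_measure_tuple R n).
Local Notation nr := (n%:R : R).
Local Notation P s := (@radial_power R n 1 s 0).
Implicit Types (x y z : 'rV[R]_n) (s d : R).

Lemma radial_power_mono s s' x : s <= s' -> P s' x <= P s x.
Proof.
move=> ss; apply: ler_powR; last by rewrite lerN2.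
exact: radial_power_base_ge1 ler01.
Qed.

Lemma laplacian_radial_power_le s s' x : 0 <= s' -> s <= s' ->
  laplacian (P s') x <= 2 * s' * (2 * s' + 2 + nr) * P (s + 1) x.
Proof.
move=> s0 ss; rewrite (laplacian_radial_power _ _ _ ler01).
have P1 : P (s' + 1) x <= P (s + 1) x by apply: radial_power_mono; lra.
have P10 : 0 <= P (s' + 1) x by exact: powR_ge0.
have P20 : 0 <= P (s' + 2) x by exact: powR_ge0.
have n0 : 0 <= nr by [].
move: (P (s' + 1) x) (P (s' + 2) x) (P (s + 1) x) P1 P10 P20 => a b c ac a0 b0.
rewrite mulr1 -[leRHS]mulrA; apply: ler_wpM2l; first by lra.
have : (2 * s' + 2 + nr) * a <= (2 * s' + 2 + nr) * c by apply: ler_wpM2l; lra.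
have : 0 <= nr * a by exact: mulr_ge0.
have : 0 <= (s' + 1) * b by apply: mulr_ge0; lra.
nra.
Qed.

(** Here - Delta P_s = 2s (d P_(s+1) + 2(s+1) P_(s+2)) has two positive terms, and the bilaplacian
    is at least - C P_(s+1). With lambda = (C+1)/(2sd), the first term alone yields (C+1)
    P_(s+1). *)
Lemma radial_power_supersolution s d : 0 < s -> 0 < d -> 2 * s = nr - 2 - d ->
  exists2 lambda : R, 0 < lambda & forall x,
    P (s + 1) x <= bilaplacian (P s) x - lambda * laplacian (P s) x.
Proof.
move=> s0 d0 sd.
pose C1 := 2 * (s + 1) * (2 * (s + 1) + 2 + nr).
pose C2 := 2 * (s + 2) * (2 * (s + 2) + 2 + nr).
pose C := 2 * s * (d * C1 + 2 * (s + 1) * C2).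
have n0 : 0 <= nr by [].
have C10 : 0 <= C1 by rewrite /C1; apply: mulr_ge0; lra.
have C20 : 0 <= C2 by rewrite /C2; apply: mulr_ge0; lra.
have C0 : 0 <= C.
  apply: mulr_ge0; first lra.
  by apply: addr_ge0; apply: mulr_ge0; lra.
have sd0 : 0 < 2 * s * d by apply: mulr_gt0 => //; lra.
exists ((C + 1) / (2 * s * d)); first by apply: divr_gt0 => //; lra.
move=> x; pose a := - (2 * s * d); pose b := - (2 * s * (2 * (s + 1))).
have a0 : a <= 0 by rewrite oppr_le0 ltW.
have b0 : b <= 0 by rewrite oppr_le0; apply: mulr_ge0; lra.
have LE : laplacian (P s) = (fun y => a * P (s + 1) y + b * P (s + 2) y).
  apply/funext => y; rewrite (laplacian_radial_power _ _ _ ler01) /a /b.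
  by rewrite (_ : 2 * s + 2 - nr = - d); [ring|lra].
have CP s' : class_C 2 (P s') := class_C_radial_power 2 s' 0 ler01.
have CZ c s' : class_C 2 (fun y => c * P s' y).
  by apply: class_CM; [exact: class_C_cst|exact: CP].
rewrite /bilaplacian LE laplacianD; [|exact: CZ|exact: CZ].
rewrite laplacianZ; last exact: CP.
rewrite laplacianZ; last exact: CP.
have L1 : laplacian (P (s + 1)) x <= C1 * P (s + 1) x.
  by apply: laplacian_radial_power_le; lra.
have L2 : laplacian (P (s + 2)) x <= C2 * P (s + 1) x.
  by apply: laplacian_radial_power_le; lra.
have P20 : 0 <= P (s + 2) x by exact: powR_ge0.
have k0 : 0 <= (C + 1) / (2 * s * d) by apply: divr_ge0; [exact: addr_ge0|exact: ltW].
have ka : (C + 1) / (2 * s * d) * a = - (C + 1).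
  by rewrite /a mulrN divfK// gt_eqF.
have CE : C = - a * C1 - b * C2 by rewrite /C /a /b; ring.
have := ler_wnM2l a0 L1; have := ler_wnM2l b0 L2.
have : (C + 1) / (2 * s * d) * (b * P (s + 2) x) <= 0.
  by apply: mulr_ge0_le0 => //; apply: mulr_le0_ge0.
rewrite mulrDr (mulrA _ a) ka CE.
move: (_ / _) (laplacian _ _) (laplacian _ _) (P (s + 1) x) (P (s + 2) x).
move=> k X Y p1 p2; clear => H1 H2 H3.
have -> : a * X + b * Y - (- (- a * C1 - b * C2 + 1) * p1 + k * (b * p2)) =
  p1 + (a * X - a * (C1 * p1)) + (b * Y - b * (C2 * p1)) - k * (b * p2) by ring.
lra.
Qed.

(** The constant does not depend on [eps], which is later chosen in terms of it. *)
Lemma convolution_radial_power_le (beta d mu p s : R) : 0 < d <= beta ->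
  d < nr -> 2 * d <= mu -> mu <= nr -> mu / 2 <= s * p ->
  exists2 C : R, 0 <= C & forall eps : R, 0 <= eps -> forall x,
    (convolution (log_kernel nr beta) (fun y => (eps * P s y) `^ p)%R x <=
     (eps `^ p * (C * P ((mu - 2 * d) / 2) x))%:E)%E.
Proof.
move=> dbeta dn dmu mun musp.
have [C C0 HC] := @convolution_decay R n beta d mu dbeta dn dmu mun.
exists C => // eps eps0 x.
have ep0 := powR_ge0 eps p.
rewrite EFinM; apply: le_trans (lee_wpmul2l _ (HC x)); last by rewrite lee_fin.
have mP : measurable_fun setT (fun t : n.-tuple rT =>
    (log_kernel nr beta (x - row_of_tuple t) * P (mu / 2) (row_of_tuple t))%:E).
  apply/measurable_EFinP; apply: measurable_funM.
    exact: measurable_log_kernel.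
  exact: measurable_radial_power.
rewrite -ge0_integralZl_EFin//; last first.
  by move=> t _; rewrite lee_fin mulr_ge0 ?log_kernel_ge0 ?powR_ge0.
apply: ge0_le_integral => //.
- by move=> t _; rewrite lee_fin mulr_ge0 ?log_kernel_ge0 ?powR_ge0.
- apply/measurable_EFinP; apply: measurable_funM.
    exact: measurable_log_kernel.
  apply: (measurableT_comp (measurable_powR p)).
  by apply: measurable_funM => //; exact: measurable_radial_power.
- by apply: emeasurable_funM.
- move=> t _; rewrite -EFinM lee_fin mulrCA.
  apply: ler_wpM2l; first exact: log_kernel_ge0.
  rewrite powRM ?powR_ge0//; apply: ler_wpM2l => //.
  by rewrite /radial_power -powRrM mulNr; exact: radial_power_mono.
Qed.

(** With g = n - 2 - d and mu = min(p g, n), the right-hand side decays fast enough when g + 2 <= mu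
    - 2d + g q. The last two inequalities are this condition for mu = p g and for mu = n; 4d <= n -
    2 gives g >= 3d, and d <= beta serves the kernel bound. *)
Lemma exponent_choice (beta p q : R) : (3 <= n)%N -> 1 <= p -> 0 < q ->
  0 < beta -> nr / (nr - 2) < p + q ->
  exists2 d, 0 < d <= beta & [/\ 4 * d <= nr - 2,
    (p + q + 1) * d <= (p + q - 1) * (nr - 2) - 2 & (q + 1) * d <= q * (nr - 2)].
Proof.
move=> n3 p1 q0 b0 pq; have nr3 := @natr_ge3 R n _ n3 erefl.
have e0 : 0 < (p + q - 1) * (nr - 2) - 2.
  by move: pq; rewrite ltr_pdivrMr; lra.
have q20 : 0 < q * (nr - 2) by apply: mulr_gt0; lra.
pose d1 := ((p + q - 1) * (nr - 2) - 2) / (p + q + 1).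
pose d2 := q * (nr - 2) / (q + 1).
have d10 : 0 < d1 by apply: divr_gt0; lra.
have d20 : 0 < d2 by apply: divr_gt0; lra.
exists (Num.min (Num.min beta ((nr - 2) / 4)) (Num.min d1 d2)).
  rewrite !lt_min b0 d10 d20 !ge_min lexx /= !andbT; lra.
have m1 : Num.min (Num.min beta ((nr - 2) / 4)) (Num.min d1 d2) <= d1.
  by rewrite !ge_min lexx !orbT.
have m2 : Num.min (Num.min beta ((nr - 2) / 4)) (Num.min d1 d2) <= d2.
  by rewrite !ge_min lexx !orbT.
have m3 : Num.min (Num.min beta ((nr - 2) / 4)) (Num.min d1 d2) <= (nr - 2) / 4.
  by rewrite !ge_min lexx !orbT.
split; first lra.
- by move: m1; rewrite ler_pdivlMr; lra.
- by move: m2; rewrite ler_pdivlMr; lra.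
Qed.

Lemma existence (beta p q : R) : (3 <= n)%N -> 1 <= p -> 0 < q -> 0 < beta ->
  nr / (nr - 2) < p + q ->
  exists2 lambda : R, 0 < lambda &
    exists2 u : 'rV[R]_n -> R,
      nonneg_solution lambda nr beta p q u & (exists x, u x != 0).
Proof.
move=> n3 p1 q0 b0 pq; have nr3 := @natr_ge3 R n _ n3 erefl.
have [d dbeta [d4 dpq dq]] := exponent_choice n3 p1 q0 b0 pq.
have d0 : 0 < d by case/andP: dbeta.
pose g := nr - 2 - d; pose s := g / 2.
have g3 : 3 * d <= g by rewrite /g; lra.
have s0 : 0 < s by rewrite /s; lra.
have pg : g <= p * g by rewrite ler_peMl//; lra.
pose mu := Num.min (p * g) nr.
have mun : mu <= nr by rewrite /mu ge_min lexx orbT.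
have mup : mu <= p * g by rewrite /mu ge_min lexx.
have dmu : 2 * d <= mu by rewrite /mu le_min; apply/andP; split; lra.
have key : s + 1 <= (mu - 2 * d) / 2 + s * q.
  suff : g + 2 <= mu - 2 * d + g * q by rewrite /s; lra.
  rewrite /mu; have [_|_] := leP (p * g) nr.
    by rewrite /g; nra.
  by rewrite /g; nra.
have [lambda l0 Hl] : exists2 lambda : R, 0 < lambda & forall x,
    P (s + 1) x <= bilaplacian (P s) x - lambda * laplacian (P s) x.
  by apply: (radial_power_supersolution s0 d0); rewrite /s /g; lra.
have [C C0 HC] : exists2 C : R, 0 <= C & forall eps : R, 0 <= eps -> forall x,
    (convolution (log_kernel nr beta) (fun y => (eps * P s y) `^ p)%R x <=
     (eps `^ p * (C * P ((mu - 2 * d) / 2) x))%:E)%E.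
  apply: (convolution_radial_power_le dbeta _ dmu mun _); first lra.
  by rewrite /s; lra.
(* Chosen so that eps^(p+q-1) = 1/(C+1), hence eps^(p+q) C <= eps. *)
pose eps := (C + 1)^-1 `^ (p + q - 1)^-1.
have C1 : 0 < (C + 1)^-1 by rewrite invr_gt0; lra.
have eps0 : 0 < eps by exact: powR_gt0.
have epsC : eps `^ (p + q - 1) * C <= 1.
  rewrite /eps -powRrM mulVf ?gt_eqF//; last by lra.
  by rewrite powRr1 ?(ltW C1)// mulrC ler_pdivrMr; lra.
have CP k : class_C k (P s) := class_C_radial_power k s 0 ler01.
exists lambda => //; exists (fun y => eps * P s y); last first.
  exists 0; rewrite gt_eqF// mulr_gt0// powR_gt0//.
  exact: lt_le_trans ltr01 (radial_power_base_ge1 _ _ ler01).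
have CL : class_C 2 (laplacian (P s)) by apply: class_C_laplacian; exact: CP.
have LE : laplacian (fun y => eps * P s y) = (fun y => eps * laplacian (P s) y).
  by apply/funext => y; apply: laplacianZ; exact: CP.
split.
- by apply: class_CM; [exact: class_C_cst|exact: CP].
- by move=> x; rewrite mulr_ge0 ?powR_ge0 ?(ltW eps0).
- by move=> x; apply: le_lt_trans (HC _ (ltW eps0) x) _; exact: ltry.
move=> x; rewrite /bilaplacian LE (laplacianZ _ _ CL).
have uq0 := powR_ge0 (eps * P s x) q.
have uq0' : (0 <= ((eps * P s x) `^ q)%:E)%E by rewrite lee_fin.
apply: le_trans (lee_wpmul2r uq0' (HC _ (ltW eps0) x)) _.
rewrite -EFinM lee_fin (mulrCA lambda) -mulrBr.
apply: le_trans (ler_wpM2l (ltW eps0) (Hl x)).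
rewrite powRM ?powR_ge0 ?(ltW eps0)//.
have h1 := radial_power_base_ge1 0 x (@ler01 R).
have h0 := lt_le_trans ltr01 h1.
have Pq : P s x `^ q = P (s * q) x by rewrite /radial_power -powRrM mulNr.
have PP : P ((mu - 2 * d) / 2) x * P (s * q) x <= P (s + 1) x.
  rewrite /radial_power -powRD; last by rewrite (gt_eqF h0) implybT.
  by rewrite -opprD; exact: radial_power_mono.
have E : eps `^ p * eps `^ q = eps * eps `^ (p + q - 1).
  rewrite -{3}(powRr1 (ltW eps0)) -!powRD ?(gt_eqF eps0) ?implybT//.
  by congr powR; ring.
rewrite Pq.
have -> : eps `^ p * (C * P ((mu - 2 * d) / 2) x) * (eps `^ q * P (s * q) x) =
  (eps `^ p * eps `^ q) * C * (P ((mu - 2 * d) / 2) x * P (s * q) x) by ring.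
rewrite E -2!(mulrA eps); apply: ler_wpM2l; first exact: ltW.
rewrite -[leRHS]mul1r; apply: ler_pM => //.
- by rewrite mulr_ge0 ?powR_ge0.
- by rewrite mulr_ge0 ?powR_ge0.
Qed.

End existence.

Theorem theorem1p4 (R : realType) (N : nat) (p q alpha beta : R)
    (hN : (3 <= N)%N) (hp : 1 <= p) (hq : 0 < q)
    (halpha : alpha = N%:R) (hbeta : 0 < beta) :
  (exists2 lambda : R, 0 < lambda &
     exists2 u : 'rV[R]_N -> R,
       nonneg_solution lambda alpha beta p q u & (exists x, u x != 0)) <->
  N%:R / (N%:R - 2) < p + q.
Proof.
subst alpha; split; last exact: existence.
by move=> [lambda l0 [u su [x ux]]]; exact: (nonexistence hN l0 hbeta hp hq su ux).
Qed.
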